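(* For every $X\in\{P\omega\}\cup\{k^\omega_\bot\mid 2\leq k\leq\omega\}$, $FO(\mathbf{\Sigma}^0_1(X))\equiv_m FO(\mathbb{N}_2)$.
   Context: $P\omega$ is the powerset of $\omega$ with the (Scott) topology generated by the sets $\uparrow F=\{A\mid F\subseteq A\subseteq\omega\}$ for finite $F\subseteq\omega$. For $2\leq k\leq\omega$, $k^\omega_\bot$ is the space of partial functions $g:\omega\rightharpoonup\{0,\dots,k-1\}$ (for $k=\omega$: partial functions $\omega\rightharpoonup\omega$) with the topology generated by the sets $\{g\mid f\subseteq g\}$ where $f$ ranges over partial functions with finite graph and $\subseteq$ is inclusion of graphs. $\mathbf{\Sigma}^0_1(X)$ denotes the lattice of all open subsets of $X$ (signature $\{\subseteq\}$), $FO(\mathbb{A})$ the set of first-order sentences true in $\mathbb{A}$, $\equiv_m$ many-one equivalence, and $\mathbb{N}_2=(\omega\cup P(\omega);\omega,P(\omega),\in,+,\times)$ second-order arithmetic. *)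

(* Defs.v *)
From Stdlib Require Import Arith List.
Import ListNotations.

Inductive recf : Type :=
| RZero : recf
| RSucc : recf
| RProj : nat -> recf
| RComp : recf -> list recf -> recf
| RPrec : recf -> recf -> recf
| RMu   : recf -> recf.

Inductive eval : recf -> list nat -> nat -> Prop :=
| eZero v : eval RZero v 0
| eSucc x v : eval RSucc (x :: v) (S x)
| eProj i v : i < length v -> eval (RProj i) v (nth i v 0)
| eComp f gs v ws y : evals gs v ws -> eval f ws y -> eval (RComp f gs) v y
| ePrec0 g h v y : eval g v y -> eval (RPrec g h) (0 :: v) y
| ePrecS g h n v r y :
    eval (RPrec g h) (n :: v) r -> eval h (n :: r :: v) y ->
    eval (RPrec g h) (S n :: v) y
| eMu f v n :
    eval f (n :: v) 0 ->
    (forall m, m < n -> exists k, eval f (m :: v) (S k)) ->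
    eval (RMu f) v n
with evals : list recf -> list nat -> list nat -> Prop :=
| esNil v : evals [] v []
| esCons g gs v y ys : eval g v y -> evals gs v ys -> evals (g :: gs) v (y :: ys).

Definition computable (f : nat -> nat) : Prop :=
  exists c : recf, forall n, eval c [n] (f n).

Definition mreducible (A B : nat -> Prop) : Prop :=
  exists f, computable f /\ forall n, A n <-> B (f n).

Definition mequiv (A B : nat -> Prop) : Prop :=
  mreducible A B /\ mreducible B A.

Inductive form : Type :=
| FEq  : nat -> nat -> form
| FRel : nat -> list nat -> form
| FFalse : form
| FNot : form -> form
| FAnd : form -> form -> form
| FOr  : form -> form -> form
| FImp : form -> form -> form
| FAll : nat -> form -> form
| FEx  : nat -> form -> form.

(* A signature lists the arity of relation symbol 0, 1, 2, ... *)
Definition signature := list nat.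

Fixpoint wf (s : signature) (p : form) : Prop :=
  match p with
  | FEq _ _ => True
  | FRel r args => nth_error s r = Some (length args)
  | FFalse => True
  | FNot a => wf s a
  | FAnd a b | FOr a b | FImp a b => wf s a /\ wf s b
  | FAll _ a | FEx _ a => wf s a
  end.

Fixpoint free_in (x : nat) (p : form) : Prop :=
  match p with
  | FEq y z => x = y \/ x = z
  | FRel _ args => In x args
  | FFalse => False
  | FNot a => free_in x a
  | FAnd a b | FOr a b | FImp a b => free_in x a \/ free_in x b
  | FAll y a | FEx y a => x <> y /\ free_in x a
  end.

Definition sentence (p : form) : Prop := forall x, ~ free_in x p.

Record structure := { dom : Type; interp : nat -> list dom -> Prop }.

Definition upd {D : Type} (rho : nat -> D) (x : nat) (d : D) : nat -> D :=
  fun y => if Nat.eqb y x then d else rho y.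

Fixpoint sat (M : structure) (rho : nat -> dom M) (p : form) : Prop :=
  match p with
  | FEq x y => rho x = rho y
  | FRel r args => interp M r (map rho args)
  | FFalse => False
  | FNot a => ~ sat M rho a
  | FAnd a b => sat M rho a /\ sat M rho b
  | FOr a b => sat M rho a \/ sat M rho b
  | FImp a b => sat M rho a -> sat M rho b
  | FAll x a => forall d, sat M (upd rho x d) a
  | FEx x a => exists d, sat M (upd rho x d) a
  end.

Definition FO (s : signature) (M : structure) (p : form) : Prop :=
  wf s p /\ sentence p /\ forall rho, sat M rho p.

Definition cpair (a b : nat) : nat := (a + b) * (a + b + 1) / 2 + b.

Fixpoint enc_list (l : list nat) : nat :=
  match l with
  | [] => 0
  | x :: l' => S (cpair x (enc_list l'))
  end.

Fixpoint enc (p : form) : nat :=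
  match p with
  | FEq x y => cpair 0 (cpair x y)
  | FRel r args => cpair 1 (cpair r (enc_list args))
  | FFalse => cpair 2 0
  | FNot a => cpair 3 (enc a)
  | FAnd a b => cpair 4 (cpair (enc a) (enc b))
  | FOr a b => cpair 5 (cpair (enc a) (enc b))
  | FImp a b => cpair 6 (cpair (enc a) (enc b))
  | FAll x a => cpair 7 (cpair x (enc a))
  | FEx x a => cpair 8 (cpair x (enc a))
  end.

Definition codes (T : form -> Prop) : nat -> Prop :=
  fun n => exists p, T p /\ enc p = n.

Definition N2_dom : Type := (nat + (nat -> Prop))%type.

Definition N2_interp (r : nat) (l : list N2_dom) : Prop :=
  match r, l with
  | 0, [inl _] => True
  | 1, [inr _] => True
  | 2, [inl n; inr A] => A n
  | 3, [inl x; inl y; inl z] => x + y = z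
  | 4, [inl x; inl y; inl z] => x * y = z
  | _, _ => False
  end.

Definition N2 : structure := {| dom := N2_dom; interp := N2_interp |}.

Definition sig_N2 : signature := [1; 1; 2; 3; 3].

Record subbased_space := { pt : Type; subbase : (pt -> Prop) -> Prop }.

Definition is_open (X : subbased_space) (U : pt X -> Prop) : Prop :=
  forall x, U x ->
    exists Bs : list (pt X -> Prop),
      (forall B, In B Bs -> subbase X B) /\
      (forall B, In B Bs -> B x) /\
      (forall y, (forall B, In B Bs -> B y) -> U y).

Definition Sigma01 (X : subbased_space) : Type :=
  { U : pt X -> Prop | is_open X U }.

Definition Sigma01_interp (X : subbased_space) (r : nat) (l : list (Sigma01 X))
  : Prop :=
  match r, l with
  | 0, [U; V] => forall x, proj1_sig U x -> proj1_sig V x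
  | _, _ => False
  end.

Definition Sigma01_str (X : subbased_space) : structure :=
  {| dom := Sigma01 X; interp := Sigma01_interp X |}.

Definition sig_lattice : signature := [2].

(* P(omega) with the Scott topology: subbase { up F | F finite }. *)
Definition Pomega : subbased_space :=
  {| pt := nat -> Prop;
     subbase := fun B => exists F : list nat,
        forall A : nat -> Prop, B A <-> (forall n, In n F -> A n) |}.

(* k^omega_bot for 2 <= k <= omega: k = Some k' (finite) or None (omega).
   Points: partial functions omega -> {0..k-1} (resp. omega). *)
Definition in_range (k : option nat) (v : nat) : Prop :=
  match k with Some k' => v < k' | None => True end.

Definition pfun (k : option nat) : Type :=
  { g : nat -> option nat | forall n v, g n = Some v -> in_range k v }.

Definition graph_sub {k : option nat} (f g : pfun k) : Prop :=
  forall n v, proj1_sig f n = Some v -> proj1_sig g n = Some v.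

Definition finite_graph {k : option nat} (f : pfun k) : Prop :=
  exists N, forall n, N <= n -> proj1_sig f n = None.

Definition Kbot (k : option nat) : subbased_space :=
  {| pt := pfun k;
     subbase := fun B => exists f : pfun k, finite_graph f /\
        forall g, B g <-> graph_sub f g |}.

(* Main.v *)
(* Both reductions are interpretations with definable parameters, realized on
   codes by course-of-values recursion.

   A point of X is determined by the atoms (n in A, resp. g(i) = v) it
   satisfies, and the basic open sets correspond to the finite consistent sets
   of atoms.  Each basic open set has a least point, so a union of basic open
   sets contains a basic open set only if one of its members does.  Given a set
   of numbers coding an enumeration of the finite consistent sets of atoms,
   a definable requirement, arbitrary sets of numbers represent the open sets,
   with inclusion definable.

   Conversely the opens with a least point are the elements d of the lattice
   having a greatest element strictly below d, and the union of any family of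
   them is open.  Numbers are represented by pairwise disjoint sets of three
   atoms, and a ternary relation by a family of 3-element sets, taking one atom
   from each of the three numbers.  The second-order Peano axioms then single
   out, up to isomorphism, the parameters coding addition and multiplication. *)

(* No parameter is definable by itself, so a sentence is translated to the statement that it holds
   for all good parameters. Hence the two things to prove are that good parameters exist, without
   which the translation would be vacuous, and that all of them yield the same structure. In
   arithmetic this replaces a definition of finite sequences by addition and multiplication: the
   enumeration is a set parameter described by closure conditions. In the lattice the obstacle is
   that there is no pairing. A finite set of atoms is unordered and the arguments of a relation may
   coincide, so each number needs three atoms of different kinds, one per argument place. A further
   obstacle is that the union of the numbers in a singleton is that number itself; a marker joined
   to every union separates sets from numbers. Induction is full second-order induction because any
   family of numbers has a union in the lattice. The only feature of the space used on this side is
   an infinite sequence of pairwise consistent atoms. *)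
Require Import Defs.
From Stdlib Require Import Arith List Lia Classical IndefiniteDescription.
From Stdlib Require Import FunctionalExtensionality PropExtensionality.
Import ListNotations.

(** * Recursive functions on codes *)

(** Functions take the whole argument list, so that the closure lemmas below apply directly to the
    body of a Rocq expression in [v] and no program has to be written out. *)
Definition rec (k : nat) (F : list nat -> nat) : Prop :=
  exists c, forall v, length v = k -> eval c v (F v).

Lemma rec_ext k F G : (forall v, length v = k -> F v = G v) -> rec k F -> rec k G.
Proof. intros E [c H]; exists c; intros v L; rewrite <- E by easy; auto. Qed.

Lemma rec_nth k i : i < k -> rec k (fun v => nth i v 0).
Proof. intros L; exists (RProj i); intros v E; constructor; lia. Qed.

Lemma rec_comp m k F (gs : list (list nat -> nat)) :
  rec m F -> length gs = m -> (forall g, In g gs -> rec k g) ->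
  rec k (fun v => F (map (fun g => g v) gs)).
Proof.
  intros [c Hc] L Hg.
  assert (exists cs, forall v, length v = k -> evals cs v (map (fun g => g v) gs)) as [cs Hs].
  { clear L; induction gs as [|g gs IH].
    - exists []; constructor.
    - destruct IH as [cs Hs]; [firstorder|].
      destruct (Hg g) as [d Hd]; [now left|].
      exists (d :: cs); intros v E; constructor; auto. }
  exists (RComp c cs); intros v E; econstructor; eauto.
  apply Hc; now rewrite length_map.
Qed.

Lemma rec_app1 f k g :
  rec 1 (fun v => f (nth 0 v 0)) -> rec k g -> rec k (fun v => f (g v)).
Proof.
  intros H Hg; apply (rec_comp 1 k _ [g] H); [easy|].
  now intros ? [<-|[]].
Qed.

Lemma rec_app2 f k g h :
  rec 2 (fun v => f (nth 0 v 0) (nth 1 v 0)) -> rec k g -> rec k h ->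
  rec k (fun v => f (g v) (h v)).
Proof.
  intros H Hg Hh; apply (rec_comp 2 k _ [g; h] H); [easy|].
  now intros ? [<-|[<-|[]]].
Qed.

Lemma rec_app3 f k g h i :
  rec 3 (fun v => f (nth 0 v 0) (nth 1 v 0) (nth 2 v 0)) ->
  rec k g -> rec k h -> rec k i ->
  rec k (fun v => f (g v) (h v) (i v)).
Proof.
  intros H Hg Hh Hi; apply (rec_comp 3 k _ [g; h; i] H); [easy|].
  now intros ? [<-|[<-|[<-|[]]]].
Qed.

Lemma rec_S k g : rec k g -> rec k (fun v => S (g v)).
Proof.
  apply rec_app1; exists RSucc; intros [|x [|]] E; try discriminate; constructor.
Qed.

Lemma rec_const k n : rec k (fun _ => n).
Proof.
  induction n as [|n IH]; [exists RZero; constructor|now apply rec_S].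
Qed.

Lemma rec_prec k (g h : list nat -> nat) :
  rec k g -> rec (S (S k)) h ->
  rec (S k) (fun v => nat_rect (fun _ => nat) (g (tl v))
                       (fun n r => h (n :: r :: tl v)) (nth 0 v 0)).
Proof.
  intros [c Hc] [d Hd]; exists (RPrec c d); intros [|n v] E; [discriminate|].
  injection E as E; cbn; induction n as [|n IH]; cbn; econstructor; eauto.
  apply Hd; cbn; lia.
Qed.

Lemma rec_prec2 (f : nat -> nat -> nat) (g : nat -> nat) (h : nat -> nat -> nat -> nat) :
  (forall y, f 0 y = g y) -> (forall n y, f (S n) y = h n (f n y) y) ->
  rec 1 (fun v => g (nth 0 v 0)) ->
  rec 3 (fun v => h (nth 0 v 0) (nth 1 v 0) (nth 2 v 0)) ->
  rec 2 (fun v => f (nth 0 v 0) (nth 1 v 0)).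
Proof.
  intros E0 ES Hg Hh; refine (rec_ext _ _ _ _ (rec_prec 1 _ _ Hg Hh)).
  intros [|n [|y [|]]] E; try discriminate; cbn.
  induction n as [|n IH]; cbn; [easy|now rewrite ES, <- IH].
Qed.

Lemma rec_prec1 (f : nat -> nat) (h : nat -> nat -> nat) :
  (forall n, f (S n) = h n (f n)) ->
  rec 2 (fun v => h (nth 0 v 0) (nth 1 v 0)) ->
  rec 1 (fun v => f (nth 0 v 0)).
Proof.
  intros ES Hh; refine (rec_ext _ _ _ _ (rec_prec 0 _ _ (rec_const 0 (f 0)) Hh)).
  intros [|n [|]] E; try discriminate; cbn.
  induction n as [|n IH]; cbn; [easy|now rewrite ES, <- IH].
Qed.

Lemma rec_mu k F (G : list nat -> nat) :
  rec (S k) F ->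
  (forall v, length v = k -> F (G v :: v) = 0 /\ forall m, m < G v -> F (m :: v) <> 0) ->
  rec k G.
Proof.
  intros [c Hc] H; exists (RMu c); intros v E; destruct (H v E) as [H0 H1].
  constructor.
  - rewrite <- H0; apply Hc; cbn; lia.
  - intros m L; exists (pred (F (m :: v))).
    specialize (H1 m L); rewrite Nat.succ_pred by easy; apply Hc; cbn; lia.
Qed.

Ltac rec_step :=
  first [ apply rec_const | apply rec_nth; cbn; lia | apply rec_S | assumption ].

Lemma rec_add k g h : rec k g -> rec k h -> rec k (fun v => g v + h v).
Proof.
  apply (rec_app2 Nat.add), (rec_prec2 _ (fun y => y) (fun _ r _ => S r)); try easy;
    repeat rec_step.
Qed.

Lemma rec_pred k g : rec k g -> rec k (fun v => pred (g v)).
Proof.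
  apply (rec_app1 pred), (rec_prec1 _ (fun n _ => n)); try easy; repeat rec_step.
Qed.

Lemma rec_sub k g h : rec k g -> rec k h -> rec k (fun v => g v - h v).
Proof.
  intros Hg Hh; apply (rec_app2 (fun y x => x - y)); auto.
  apply (rec_prec2 (fun y x => x - y) (fun y => y) (fun _ r _ => pred r)); try (intros; lia);
    repeat first [rec_step | apply rec_pred].
Qed.

Definition if0 (e x y : nat) : nat := match e with 0 => x | S _ => y end.

Lemma rec_if0 k e g h : rec k e -> rec k g -> rec k h -> rec k (fun v => if0 (e v) (g v) (h v)).
Proof.
  apply (rec_app3 if0).
  refine (rec_ext _ _ _ _ (rec_prec 2 (fun v => nth 0 v 0) (fun v => nth 3 v 0) _ _));
    repeat rec_step.
  intros [|[|n] [|x [|y [|]]]] E; try discriminate; reflexivity.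
Qed.

Definition ifeq (a b x y : nat) : nat := if a =? b then x else y.

Lemma rec_ifeq k a b g h : rec k a -> rec k b -> rec k g -> rec k h ->
  rec k (fun v => ifeq (a v) (b v) (g v) (h v)).
Proof.
  intros Ha Hb Hg Hh.
  apply rec_ext with (fun v => if0 ((a v - b v) + (b v - a v)) (g v) (h v)).
  - intros v _; unfold ifeq; destruct (Nat.eqb_spec (a v) (b v)) as [->|N].
    + now rewrite Nat.sub_diag.
    + destruct (a v - b v + (b v - a v)) eqn:E; [lia|easy].
  - auto using rec_if0, rec_add, rec_sub.
Qed.

(** * The Cantor pairing, its inverses, and coded lists *)

Fixpoint tri (n : nat) : nat := match n with 0 => 0 | S m => tri m + S m end.

Lemma tri_double n : 2 * tri n = n * (n + 1).
Proof. induction n; cbn [tri]; lia. Qed.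

Lemma cpair_tri a b : cpair a b = tri (a + b) + b.
Proof.
  unfold cpair; rewrite <- tri_double, Nat.mul_comm, Nat.div_mul; lia.
Qed.

Lemma tri_mono m n : m <= n -> tri m <= tri n.
Proof. induction 1; cbn [tri]; lia. Qed.

Lemma rec_tri k g : rec k g -> rec k (fun v => tri (g v)).
Proof.
  apply (rec_app1 tri), (rec_prec1 _ (fun n r => r + S n)); try easy.
  apply rec_add; repeat rec_step.
Qed.

Lemma rec_cpair k g h : rec k g -> rec k h -> rec k (fun v => cpair (g v) (h v)).
Proof.
  intros Hg Hh; apply rec_ext with (fun v => tri (g v + h v) + h v).
  - intros; now rewrite cpair_tri.
  - auto using rec_add, rec_tri.
Qed.

(** The greatest [r] with [tri r <= z], which recovers [a + b] from [cpair a b]. It grows by at most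
    one from [z] to [S z]. *)
Fixpoint tri_root (z : nat) : nat :=
  match z with
  | 0 => 0
  | S z' => if tri (S (tri_root z')) <=? z then S (tri_root z') else tri_root z'
  end.

Lemma tri_root_spec z : tri (tri_root z) <= z < tri (S (tri_root z)).
Proof.
  induction z as [|z IH]; [cbn; lia|].
  cbn [tri_root]; destruct (Nat.leb_spec (tri (S (tri_root z))) (S z)) as [L|L];
    cbn [tri] in *; lia.
Qed.

Definition csnd (z : nat) : nat := z - tri (tri_root z).
Definition cfst (z : nat) : nat := tri_root z - csnd z.

Lemma cpair_surj z : cpair (cfst z) (csnd z) = z.
Proof.
  pose proof (tri_root_spec z) as H; cbn [tri] in H; rewrite cpair_tri; unfold cfst, csnd.
  rewrite Nat.sub_add by lia; lia.
Qed.

Lemma tri_root_cpair a b : tri_root (cpair a b) = a + b.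
Proof.
  pose proof (tri_root_spec (cpair a b)) as H; rewrite cpair_tri in *.
  assert (T := tri_mono).
  destruct (lt_eq_lt_dec (tri_root (tri (a + b) + b)) (a + b)) as [[L|L]|L]; [|easy|].
  - specialize (T _ _ L); cbn [tri] in *; lia.
  - specialize (T _ _ L); cbn [tri] in *; lia.
Qed.

Lemma csnd_cpair a b : csnd (cpair a b) = b.
Proof. unfold csnd; rewrite tri_root_cpair, cpair_tri; lia. Qed.

Lemma cfst_cpair a b : cfst (cpair a b) = a.
Proof. unfold cfst; rewrite csnd_cpair, tri_root_cpair; lia. Qed.

Lemma cpair_inj a b c d : cpair a b = cpair c d -> a = c /\ b = d.
Proof.
  intros E; split.
  - now rewrite <- (cfst_cpair a b), E, cfst_cpair.
  - now rewrite <- (csnd_cpair a b), E, csnd_cpair.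
Qed.

Lemma le_cpair_l a b : a <= cpair a b.
Proof.
  rewrite cpair_tri; assert (forall n, n <= tri n) as H by (induction n; cbn [tri]; lia).
  specialize (H (a + b)); lia.
Qed.

Lemma le_cpair_r a b : b <= cpair a b.
Proof. rewrite cpair_tri; lia. Qed.

(** The strictness for nonzero tags makes recursion on formula codes well-founded; tag 0 belongs to
    equations, which have no subformulas. *)
Lemma lt_cpair_r a b : b < cpair (S a) b.
Proof. rewrite cpair_tri; cbn [Nat.add tri]; lia. Qed.

Lemma rec_tri_root k g : rec k g -> rec k (fun v => tri_root (g v)).
Proof.
  apply (rec_app1 tri_root).
  (* The difference vanishes exactly when [z < tri (S r)], and the least such [r] is the root. *)
  apply rec_mu with (fun v => S (nth 1 v 0) - tri (S (nth 0 v 0))).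
  - apply rec_sub; [|apply rec_tri]; repeat rec_step.
  - intros [|z [|]] E; try discriminate; cbn [nth].
    pose proof (tri_root_spec z) as H; split; [lia|].
    intros m L; pose proof (tri_mono (S m) _ L); lia.
Qed.

Lemma rec_csnd k g : rec k g -> rec k (fun v => csnd (g v)).
Proof. intros; unfold csnd; auto using rec_sub, rec_tri, rec_tri_root. Qed.

Lemma rec_cfst k g : rec k g -> rec k (fun v => cfst (g v)).
Proof. intros; unfold cfst; auto using rec_sub, rec_tri_root, rec_csnd. Qed.

(** [pred] removes the successor that [enc_list] puts on nonempty lists. Since both components of 0
    are 0, reading past the end gives 0, the default used with [nth]. *)
Fixpoint tail_iter (j l : nat) : nat :=
  match j with 0 => l | S j => csnd (pred (tail_iter j l)) end.
Definition lookup (j l : nat) : nat := cfst (pred (tail_iter j l)).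

Lemma rec_lookup k g h : rec k g -> rec k h -> rec k (fun v => lookup (g v) (h v)).
Proof.
  intros; unfold lookup; apply rec_cfst, rec_pred, (rec_app2 tail_iter); auto.
  apply (rec_prec2 _ (fun y => y) (fun _ r _ => csnd (pred r))); try easy;
    repeat first [rec_step | apply rec_csnd | apply rec_pred].
Qed.

Lemma lookup_0 x l : lookup 0 (S (cpair x l)) = x.
Proof. apply cfst_cpair. Qed.

Lemma lookup_S j x l : lookup (S j) (S (cpair x l)) = lookup j l.
Proof.
  unfold lookup; do 2 f_equal; induction j as [|j IH]; cbn in *.
  - apply csnd_cpair.
  - now rewrite IH.
Qed.

Lemma lookup_enc_list j l : lookup j (enc_list l) = nth j l 0.
Proof.
  revert j; induction l as [|x l IH]; intros j; cbn [enc_list].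
  - assert (tail_iter j 0 = 0) as E by (induction j as [|j IH]; [easy|cbn; now rewrite IH]).
    unfold lookup; rewrite E; now destruct j.
  - destruct j; [apply lookup_0|rewrite lookup_S; apply IH].
Qed.

Lemma enc_list_inj l l' : enc_list l = enc_list l' -> l = l'.
Proof.
  revert l'; induction l as [|x l IH]; intros [|y l'] E; try easy.
  injection E as [-> E]%cpair_inj; f_equal; auto.
Qed.

Lemma enc_inj p q : enc p = enc q -> p = q.
Proof.
  revert q; induction p; intros [] E; cbn [enc] in E; apply cpair_inj in E as [E1 E];
    try discriminate; try apply cpair_inj in E as [? E]; subst; f_equal; auto.
  now apply enc_list_inj.
Qed.

Lemma rec_enc_list k (gs : list (list nat -> nat)) :
  (forall g, In g gs -> rec k g) -> rec k (fun v => enc_list (map (fun g => g v) gs)).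
Proof.
  induction gs as [|g gs IH]; intros H; cbn [map enc_list]; [apply rec_const|].
  apply rec_S, rec_cpair; [apply H; now left|apply IH; firstorder].
Qed.

(* [hist step n] is the code of the list of the values at [n-1, ..., 0]. *)
Fixpoint hist (step : nat -> nat -> nat) (n : nat) : nat :=
  match n with
  | 0 => 0
  | S m => S (cpair (step m (hist step m)) (hist step m))
  end.

Definition cov (step : nat -> nat -> nat) (n : nat) : nat := step n (hist step n).

Lemma lookup_hist step n m : m < n -> lookup (n - S m) (hist step n) = cov step m.
Proof.
  induction n as [|n IH]; intros L; [lia|].
  destruct (Nat.eq_dec m n) as [->|N].
  - rewrite Nat.sub_diag; apply lookup_0.
  - replace (S n - S m) with (S (n - S m)) by lia.
    cbn [hist]; rewrite lookup_S; apply IH; lia.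
Qed.

Lemma rec_cov k g step :
  rec 2 (fun v => step (nth 0 v 0) (nth 1 v 0)) -> rec k g -> rec k (fun v => cov step (g v)).
Proof.
  intros Hs; apply (rec_app1 (cov step)); unfold cov.
  apply (rec_app2 step _ (fun v => nth 0 v 0)); [easy|repeat rec_step|].
  apply (rec_prec1 _ (fun m r => S (cpair (step m r) r))); [easy|].
  apply rec_S, rec_cpair; repeat rec_step.
Qed.

Lemma rec_computable f : rec 1 (fun v => f (nth 0 v 0)) -> computable f.
Proof. intros [c H]; exists c; intros n; now apply (H [n]). Qed.

(** * Interpretations with parameters *)

Lemma upd_eq {D} (rho : nat -> D) x d : upd rho x d x = d.
Proof. unfold upd; now rewrite Nat.eqb_refl. Qed.

Lemma upd_neq {D} (rho : nat -> D) x y d : y <> x -> upd rho x d y = rho y.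
Proof. unfold upd; now destruct (Nat.eqb_spec y x). Qed.

Lemma sat_ext M p : forall rho rho', (forall x, free_in x p -> rho x = rho' x) ->
  sat M rho p <-> sat M rho' p.
Proof.
  induction p; intros rho rho' E; cbn [sat free_in] in *.
  - rewrite !E; tauto.
  - rewrite (map_ext_in rho rho'); [tauto|auto].
  - tauto.
  - rewrite (IHp rho rho'); [tauto|auto].
  - rewrite (IHp1 rho rho'), (IHp2 rho rho'); [tauto|auto|auto].
  - rewrite (IHp1 rho rho'), (IHp2 rho rho'); [tauto|auto|auto].
  - rewrite (IHp1 rho rho'), (IHp2 rho rho'); [tauto|auto|auto].
  - assert (forall d, sat M (upd rho n d) p <-> sat M (upd rho' n d) p) as H; [|firstorder].
    intros d; apply IHp; intros x F; unfold upd; destruct (Nat.eqb_spec x n); auto.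
  - assert (forall d, sat M (upd rho n d) p <-> sat M (upd rho' n d) p) as H; [|firstorder].
    intros d; apply IHp; intros x F; unfold upd; destruct (Nat.eqb_spec x n); auto.
Qed.

(* Substitution of [l] for the variables [i, i+1, ...] of [t] by binding them,
   so that the code of [t] is a constant and no capture can occur. *)
Fixpoint inst (i : nat) (l : list nat) (t : form) : form :=
  match l with
  | [] => t
  | x :: l' => FEx i (FAnd (FEq i x) (inst (S i) l' t))
  end.

Fixpoint updl {D} (rho : nat -> D) (i : nat) (ds : list D) : nat -> D :=
  match ds with [] => rho | d :: ds' => updl (upd rho i d) (S i) ds' end.

Lemma updl_lt {D} (ds : list D) : forall rho i x, x < i -> updl rho i ds x = rho x.
Proof.
  induction ds as [|d ds IH]; intros; cbn; [easy|].
  rewrite IH, upd_neq; lia || easy.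
Qed.

Lemma map_updl_seq {D} (ds : list D) : forall rho i,
  map (updl rho i ds) (seq i (length ds)) = ds.
Proof.
  induction ds as [|d ds IH]; intros; cbn; [easy|].
  now rewrite updl_lt, upd_eq, IH by lia.
Qed.

(** The bindings are made one after the other, but they act as a simultaneous assignment because no
    variable in [l] belongs to the block being rebound. *)
Lemma sat_inst M t l : forall i rho, (forall x, In x l -> i + length l <= x) ->
  sat M rho (inst i l t) <-> sat M (updl rho i (map rho l)) t.
Proof.
  induction l as [|x l IH]; intros i rho H; cbn; [tauto|].
  cbn [length] in H.
  assert (x <> i) as Nx by (specialize (H x); cbn in H; lia).
  assert (forall d, sat M (upd rho i d) (inst (S i) l t) <->
                    sat M (updl (upd rho i d) (S i) (map rho l)) t) as E.
  { intros d; rewrite IH.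
    - rewrite (map_ext_in _ rho); [tauto|].
      intros y Hy; apply upd_neq; specialize (H y); cbn in H; lia || intuition lia.
    - intros y Hy; specialize (H y); cbn in H; intuition lia. }
  split.
  - intros (d & Ed & Hd); rewrite upd_eq, upd_neq in Ed by easy; subst d.
    now apply E.
  - intros Hd; exists (rho x); rewrite upd_eq, upd_neq by easy; now rewrite E.
Qed.

Lemma free_inst y t l : forall i, (forall x, In x l -> i + length l <= x) ->
  free_in y (inst i l t) <-> In y l \/ (free_in y t /\ ~ (i <= y < i + length l)).
Proof.
  induction l as [|x l IH]; intros i H; cbn [inst free_in In length] in *.
  - intuition lia.
  - rewrite IH by (intros z Hz; specialize (H z); intuition lia).
    assert (i + S (length l) <= x) by auto.
    assert (In y l -> i + S (length l) <= y) by auto.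
    destruct (Nat.eq_dec y x); intuition lia.
Qed.

Lemma wf_inst s t l : forall i, wf s (inst i l t) <-> wf s t.
Proof. induction l as [|x l IH]; intros i; cbn; [tauto|rewrite IH; tauto]. Qed.

Fixpoint alls (n : nat) (p : form) : form :=
  match n with 0 => p | S m => FAll m (alls m p) end.

Lemma sat_alls M p n : forall rho,
  sat M rho (alls n p) <->
  forall rho', (forall i, n <= i -> rho' i = rho i) -> sat M rho' p.
Proof.
  induction n as [|n IH]; intros rho; cbn.
  - split; [|auto with arith].
    intros H rho' E; rewrite (sat_ext _ _ _ rho); [easy|auto with arith].
  - split.
    + intros H rho' E; specialize (H (rho' n)); rewrite IH in H; apply H.
      intros i L; unfold upd; destruct (Nat.eqb_spec i n); [now subst|apply E; lia].
    + intros H d; rewrite IH; intros rho' E; apply H.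
      intros i L; rewrite E, upd_neq by lia; easy.
Qed.

Lemma free_alls x p n : free_in x (alls n p) <-> n <= x /\ free_in x p.
Proof. induction n as [|n IH]; cbn; [|rewrite IH]; intuition lia. Qed.

Lemma wf_alls s p n : wf s (alls n p) <-> wf s p.
Proof. induction n as [|n IH]; cbn; tauto. Qed.

(* An interpretation with parameters.  The parameters are the variables below
   [npar], constrained by [good]; the arguments of the formulas defining
   equality and the relations are the variables from [npar] on; a variable
   [x] of the interpreted formula becomes [shift + x].  [rels] lists the
   relations with their arities. *)
Record interpretation := {
  npar : nat;
  shift : nat;
  eqf : form;
  rels : list (nat * form);
  good : form
}.

Record wf_interpretation (s' : signature) (I : interpretation) : Prop := {
  wf_eqf : wf s' (eqf I);
  wf_rels : forall n t, In (n, t) (rels I) -> wf s' t;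
  wf_good : wf s' (good I);
  fv_eqf : forall x, free_in x (eqf I) -> x < npar I + 2;
  fv_rels : forall n t x, In (n, t) (rels I) -> free_in x t -> x < npar I + n;
  fv_good : forall x, free_in x (good I) -> x < npar I;
  shift_eqf : npar I + 2 <= shift I;
  shift_rels : forall n t, In (n, t) (rels I) -> npar I + n <= shift I
}.

(** Its symbol lies just outside the signature. Ill-formedness passes through every connective, so a
    formula containing [bad] is never in [FO]. *)
Definition bad (s' : signature) : form := FRel (length s') [].

Lemma bad_not_wf s' : ~ wf s' (bad s').
Proof.
  cbn; intros H; assert (length s' < length s') by (apply nth_error_Some; congruence); lia.
Qed.

Fixpoint trans (s' : signature) (I : interpretation) (p : form) : form :=
  match p with
  | FEq x y => inst (npar I) [shift I + x; shift I + y] (eqf I)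
  | FRel r args =>
      match nth_error (rels I) r with
      | Some (n, t) =>
          if length args =? n then inst (npar I) (map (Nat.add (shift I)) args) t
          else bad s'
      | None => bad s'
      end
  | FFalse => FFalse
  | FNot a => FNot (trans s' I a)
  | FAnd a b => FAnd (trans s' I a) (trans s' I b)
  | FOr a b => FOr (trans s' I a) (trans s' I b)
  | FImp a b => FImp (trans s' I a) (trans s' I b)
  | FAll x a => FAll (shift I + x) (trans s' I a)
  | FEx x a => FEx (shift I + x) (trans s' I a)
  end.

Definition trans_sentence (s' : signature) (I : interpretation) (p : form) : form :=
  alls (npar I) (FImp (good I) (trans s' I p)).

(** [h] may depend on the parameters. It is defined on all of [N] and onto [M], so quantifiers
    translate to unrestricted quantifiers, and several elements of [N] may represent the same one of
    [M]. The first clause prevents [trans_sentence] from being vacuously true. *)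
Definition interpretation_of (I : interpretation) (M N : structure) : Prop :=
  (exists rho, sat N rho (good I)) /\
  forall rho, sat N rho (good I) -> exists h : dom N -> dom M,
    (forall m, exists d, h d = m) /\
    forall rho', (forall i, i < npar I -> rho' i = rho i) ->
      (sat N rho' (eqf I) <-> h (rho' (npar I)) = h (rho' (S (npar I)))) /\
      (forall r n t, nth_error (rels I) r = Some (n, t) ->
         sat N rho' t <-> interp M r (map h (map rho' (seq (npar I) n)))).

Section Translation.
Context (s s' : signature) (I : interpretation).
Context (WI : wf_interpretation s' I) (Hs : s = map fst (rels I)).

Lemma nth_error_sig r : nth_error s r = option_map fst (nth_error (rels I) r).
Proof. subst s; apply nth_error_map. Qed.

Lemma args_bound n t args : In (n, t) (rels I) -> length args = n ->
  forall x, In x (map (Nat.add (shift I)) args) ->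
  npar I + length (map (Nat.add (shift I)) args) <= x.
Proof.
  intros Hin L x (y & <- & _)%in_map_iff; rewrite length_map, L.
  pose proof (shift_rels _ _ WI _ _ Hin); lia.
Qed.

Lemma eq_args_bound x y : forall z, In z [shift I + x; shift I + y] ->
  npar I + length [shift I + x; shift I + y] <= z.
Proof. pose proof (shift_eqf _ _ WI); intros z [<-|[<-|[]]]; cbn; lia. Qed.

Lemma wf_trans p : wf s' (trans s' I p) <-> wf s p.
Proof.
  induction p; cbn -[inst]; try tauto.
  - rewrite wf_inst; pose proof (wf_eqf _ _ WI); tauto.
  - rewrite nth_error_sig; destruct (nth_error (rels I) n) as [[m t]|] eqn:E; cbn -[bad].
    + destruct (Nat.eqb_spec (length l) m) as [L|L].
      * rewrite wf_inst; apply nth_error_In, (wf_rels _ _ WI) in E.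
        split; [now intros _; subst|easy].
      * split; [now intros ?%bad_not_wf|congruence].
    + split; [now intros ?%bad_not_wf|easy].
Qed.

Lemma free_trans y p : free_in y (trans s' I p) ->
  y < npar I \/ exists x, y = shift I + x /\ free_in x p.
Proof.
  induction p; cbn -[inst].
  - rewrite free_inst by apply eq_args_bound; cbn [length].
    intros [[<-|[<-|[]]]|[F N]]; eauto.
    apply (fv_eqf _ _ WI) in F; lia.
  - destruct (nth_error (rels I) n) as [[m t]|] eqn:E; [|easy].
    destruct (Nat.eqb_spec (length l) m) as [L|L]; [|easy].
    apply nth_error_In in E; rewrite free_inst by now apply (args_bound m t).
    rewrite length_map, in_map_iff; intros [(x & <- & F)|[F N]]; eauto.
    apply (fv_rels _ _ WI _ _ _ E) in F; lia.
  - easy.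
  - auto.
  - intros [H|H]; firstorder.
  - intros [H|H]; firstorder.
  - intros [H|H]; firstorder.
  - intros [N H]; destruct (IHp H) as [|(x & -> & F)]; eauto.
    right; exists x; repeat split; auto; congruence.
  - intros [N H]; destruct (IHp H) as [|(x & -> & F)]; eauto.
    right; exists x; repeat split; auto; congruence.
Qed.

(** [inst] mentions each of its arguments even if the defining formula ignores it, so no free
    variable is lost and a well-formed formula that is not a sentence does not become one. *)
Lemma free_trans_shift x p : wf s p -> free_in x p -> free_in (shift I + x) (trans s' I p).
Proof.
  induction p; cbn -[inst].
  - rewrite free_inst by apply eq_args_bound; cbn; intuition congruence.
  - rewrite nth_error_sig; destruct (nth_error (rels I) n) as [[m t]|] eqn:E; [|easy].
    intros L F; injection L as ->; rewrite Nat.eqb_refl; apply nth_error_In in E.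
    rewrite free_inst by now apply (args_bound (length l) t).
    left; now apply in_map.
  - easy.
  - easy.
  - intuition.
  - intuition.
  - intuition.
  - intuition lia.
  - intuition lia.
Qed.

Lemma sentence_trans p : wf s p -> sentence (trans_sentence s' I p) <-> sentence p.
Proof.
  intros W; unfold sentence, trans_sentence; split; intros H x F.
  - apply (H (shift I + x)); rewrite free_alls; split.
    + pose proof (shift_eqf _ _ WI); lia.
    + right; now apply free_trans_shift.
  - rewrite free_alls in F; destruct F as [L [F|F]].
    + apply (fv_good _ _ WI) in F; lia.
    + apply free_trans in F as [|(y & -> & F)]; [lia|firstorder].
Qed.

Lemma wf_trans_sentence p : wf s' (trans_sentence s' I p) <-> wf s p.
Proof.
  unfold trans_sentence; rewrite wf_alls; cbn; rewrite wf_trans.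
  pose proof (wf_good _ _ WI); tauto.
Qed.

Lemma sat_trans M N rho0 (h : dom N -> dom M) :
  (forall m, exists d, h d = m) ->
  (forall rho', (forall i, i < npar I -> rho' i = rho0 i) ->
      (sat N rho' (eqf I) <-> h (rho' (npar I)) = h (rho' (S (npar I)))) /\
      (forall r n t, nth_error (rels I) r = Some (n, t) ->
         sat N rho' t <-> interp M r (map h (map rho' (seq (npar I) n))))) ->
  forall p rho', wf s p -> (forall i, i < npar I -> rho' i = rho0 i) ->
  sat N rho' (trans s' I p) <-> sat M (fun x => h (rho' (shift I + x))) p.
Proof.
  intros Surj Hat.
  (* The quantifier step: updating the shifted variable by [d] amounts, after applying [h], to
     updating [x] by [h d]. Surjectivity of [h] then covers all of [M]. *)
  assert (forall p rho' x, (forall d, sat N (upd rho' (shift I + x) d) (trans s' I p) <->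
     sat M (fun y => h (upd rho' (shift I + x) d (shift I + y))) p) ->
     forall d, sat N (upd rho' (shift I + x) d) (trans s' I p) <->
     sat M (upd (fun y => h (rho' (shift I + y))) x (h d)) p) as Q.
  { intros p rho' x IH d; rewrite IH; apply sat_ext; intros y _; unfold upd.
    destruct (Nat.eqb_spec y x) as [->|Ne]; [now rewrite Nat.eqb_refl|].
    destruct (Nat.eqb_spec (shift I + y) (shift I + x)); [lia|easy]. }
  assert (npar I < shift I) as Sh by (pose proof (shift_eqf _ _ WI); lia).
  assert (forall (rho' : nat -> dom N) x d, (forall i, i < npar I -> rho' i = rho0 i) ->
    forall i, i < npar I -> upd rho' (shift I + x) d i = rho0 i) as Ag.
  { intros rho' x d H i L; rewrite upd_neq by lia; auto. }
  induction p; intros rho' W A; cbn -[inst] in *.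
  - rewrite sat_inst by apply eq_args_bound.
    cbn -[updl].
    destruct (Hat (updl rho' (npar I) [rho' (shift I + n); rho' (shift I + n0)])) as [H _].
    { intros i L; rewrite updl_lt by easy; auto. }
    rewrite H; cbn; unfold upd; rewrite !Nat.eqb_refl.
    destruct (Nat.eqb_spec (npar I) (S (npar I))); [lia|tauto].
  - rewrite nth_error_sig in W; destruct (nth_error (rels I) n) as [[m t]|] eqn:E; [|easy].
    injection W as ->; rewrite Nat.eqb_refl.
    pose proof (nth_error_In _ _ E) as E'; rewrite sat_inst by now apply (args_bound (length l) t).
    rewrite map_map.
    destruct (Hat (updl rho' (npar I) (map (fun x => rho' (shift I + x)) l))) as [_ H].
    { intros i L; rewrite updl_lt by easy; auto. }
    rewrite (H _ _ _ E).
    rewrite <- (length_map (fun x => rho' (shift I + x)) l).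
    rewrite map_updl_seq, map_map; tauto.
  - tauto.
  - rewrite IHp; tauto.
  - rewrite IHp1, IHp2; tauto.
  - rewrite IHp1, IHp2; tauto.
  - rewrite IHp1, IHp2; tauto.
  - assert (forall d, sat N (upd rho' (shift I + n) d) (trans s' I p) <->
     sat M (upd (fun y => h (rho' (shift I + y))) n (h d)) p) as E
     by (apply Q; intros d; apply IHp; auto).
    split; intros H d; [|now apply E].
    destruct (Surj d) as [e <-]; now apply E.
  - assert (forall d, sat N (upd rho' (shift I + n) d) (trans s' I p) <->
     sat M (upd (fun y => h (rho' (shift I + y))) n (h d)) p) as E
     by (apply Q; intros d; apply IHp; auto).
    split; intros [d H]; [exists (h d); now apply E|].
    destruct (Surj d) as [e <-]; exists e; now apply E.
Qed.

Lemma FO_trans M N p : interpretation_of I M N ->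
  FO s' N (trans_sentence s' I p) <-> FO s M p.
Proof.
  intros [[rho0 G0] HI]; unfold FO; rewrite wf_trans_sentence.
  split; intros (W & S & H); pose proof (sentence_trans p W) as ES.
  - split; [easy|]; apply ES in S; split; [easy|]; intros rho.
    specialize (H rho0); unfold trans_sentence in H; rewrite sat_alls in H.
    destruct (HI rho0 G0) as (h & Surj & Hat).
    assert (sat N rho0 (trans s' I p)) as Hp by (apply (H rho0); auto).
    rewrite (sat_trans M N rho0 h Surj Hat p rho0 W) in Hp by auto.
    rewrite sat_ext; [exact Hp|]; intros x F; now destruct (S x).
  - split; [easy|]; split; [now apply ES|]; intros rho.
    unfold trans_sentence; rewrite sat_alls; intros rho' _ G.
    destruct (HI rho' G) as (h & Surj & Hat).
    rewrite (sat_trans M N rho' h Surj Hat p rho' W) by auto; auto.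
Qed.

End Translation.

(** * The translation as a recursive function on codes *)

Fixpoint inst_code (i : nat) (l : list nat) (e : nat) : nat :=
  match l with
  | [] => e
  | x :: l' => cpair 8 (cpair i (cpair 4 (cpair (cpair 0 (cpair i x)) (inst_code (S i) l' e))))
  end.

Lemma inst_codeE t l : forall i, enc (inst i l t) = inst_code i l (enc t).
Proof. induction l as [|x l IH]; intros i; cbn [inst enc inst_code]; congruence. Qed.

Lemma rec_inst_code k e (gs : list (list nat -> nat)) :
  (forall g, In g gs -> rec k g) ->
  forall i, rec k (fun v => inst_code i (map (fun g => g v) gs) e).
Proof.
  intros H; induction gs as [|g gs IH]; intros i; cbn [map inst_code]; [apply rec_const|].
  repeat apply rec_cpair; try apply rec_const; [apply H; now left|apply IH; firstorder].
Qed.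

(** Whether [a] codes a list of length [n] is tested by reading [n] entries, encoding them again and
    comparing with [a]. *)
Fixpoint rel_code (b np c : nat) (ts : list (nat * form)) (r a : nat) : nat :=
  match ts with
  | [] => b
  | (n, t) :: ts' =>
      if0 r (ifeq a (enc_list (map (fun j => lookup j a) (seq 0 n)))
               (inst_code np (map (fun j => c + lookup j a) (seq 0 n)) (enc t)) b)
            (rel_code b np c ts' (pred r) a)
  end.

Lemma rec_rel_code k b np c ts : forall r a, rec k r -> rec k a ->
  rec k (fun v => rel_code b np c ts (r v) (a v)).
Proof.
  induction ts as [|[n t] ts IH]; intros r a Hr Ha; cbn [rel_code]; [apply rec_const|].
  apply rec_if0; [easy|apply rec_ifeq|apply (IH (fun v => pred (r v))); auto using rec_pred];
    [easy| | |apply rec_const].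
  - apply rec_ext with (fun v => enc_list (map (fun g : list nat -> nat => g v)
       (map (fun j v => lookup j (a v)) (seq 0 n)))).
    { intros; now rewrite map_map. }
    apply rec_enc_list; intros g (j & <- & _)%in_map_iff.
    apply rec_lookup; auto using rec_const.
  - apply rec_ext with (fun v => inst_code np (map (fun g : list nat -> nat => g v)
       (map (fun j v => c + lookup j (a v)) (seq 0 n))) (enc t)).
    { intros; now rewrite map_map. }
    apply rec_inst_code; intros g (j & <- & _)%in_map_iff.
    apply rec_add; [apply rec_const|]; apply rec_lookup; auto using rec_const.
Qed.

Lemma map_nth_seq {A} (f : nat -> A) l : map (fun j => f (nth j l 0)) (seq 0 (length l)) = map f l.
Proof.
  induction l as [|x l IH]; cbn; [easy|].
  now rewrite <- seq_shift, map_map; f_equal.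
Qed.

Lemma rel_codeE s' I r args :
  rel_code (enc (bad s')) (npar I) (shift I) (rels I) r (enc_list args) =
  enc (trans s' I (FRel r args)).
Proof.
  cbn [trans]; revert r; induction (rels I) as [|[n t] ts IH]; intros r;
    cbn [rel_code]; [now destruct r|].
  destruct r as [|r]; cbn [nth_error if0]; [|apply IH].
  unfold ifeq.
  destruct (Nat.eqb_spec (enc_list args)
    (enc_list (map (fun j => lookup j (enc_list args)) (seq 0 n)))) as [E|E];
  destruct (Nat.eqb_spec (length args) n) as [L|L]; [| | |easy].
  - subst n; rewrite inst_codeE; f_equal.
    rewrite <- (map_nth_seq (Nat.add (shift I))); apply map_ext; intros j.
    now rewrite lookup_enc_list.
  - apply enc_list_inj in E; destruct L; rewrite E, length_map, length_seq; easy.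
  - destruct E; subst n; f_equal.
    rewrite <- (map_id args) at 1; rewrite <- (map_nth_seq (fun x => x)).
    apply map_ext; intros j; now rewrite lookup_enc_list.
Qed.

(** Consequently every number with tag 1 is the code of some formula, possibly an ill-formed one. *)
Lemma enc_list_surj n : exists l, enc_list l = n.
Proof.
  induction n as [[|n] IH] using lt_wf_ind; [now exists []|].
  destruct (IH (csnd n)) as [l E].
  { pose proof (le_cpair_r (cfst n) (csnd n)); rewrite cpair_surj in *; lia. }
  exists (cfst n :: l); cbn [enc_list]; now rewrite E, cpair_surj.
Qed.

(** The tags are those of [enc]. The history lists the latest value first, so the value at a smaller
    code [m] is at index [n - S m]. *)
Definition trans_step (s' : signature) (I : interpretation) (n h : nat) : nat :=
  ifeq (cfst n) 0
    (inst_code (npar I) (map (fun x => shift I + x) [cfst (csnd n); csnd (csnd n)])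
       (enc (eqf I)))
  (ifeq (cfst n) 1
    (rel_code (enc (bad s')) (npar I) (shift I) (rels I) (cfst (csnd n)) (csnd (csnd n)))
  (ifeq (cfst n) 2 (if0 (csnd n) (cpair 2 0) (enc (bad s')))
  (ifeq (cfst n) 3 (cpair 3 (lookup (n - S (csnd n)) h))
  (ifeq (cfst n) 4 (cpair 4 (cpair (lookup (n - S (cfst (csnd n))) h)
                                   (lookup (n - S (csnd (csnd n))) h)))
  (ifeq (cfst n) 5 (cpair 5 (cpair (lookup (n - S (cfst (csnd n))) h)
                                   (lookup (n - S (csnd (csnd n))) h)))
  (ifeq (cfst n) 6 (cpair 6 (cpair (lookup (n - S (cfst (csnd n))) h)
                                   (lookup (n - S (csnd (csnd n))) h)))
  (ifeq (cfst n) 7 (cpair 7 (cpair (shift I + cfst (csnd n))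
                                   (lookup (n - S (csnd (csnd n))) h)))
  (ifeq (cfst n) 8 (cpair 8 (cpair (shift I + cfst (csnd n))
                                   (lookup (n - S (csnd (csnd n))) h)))
  (enc (bad s')))))))))).

Definition trans_code (s' : signature) (I : interpretation) : nat -> nat :=
  cov (trans_step s' I).

Lemma rec_trans_code k s' I g : rec k g -> rec k (fun v => trans_code s' I (g v)).
Proof.
  apply rec_cov; unfold trans_step.
  assert (rec 2 (fun v => nth 0 v 0)) as H0 by (apply rec_nth; lia).
  assert (rec 2 (fun v => nth 1 v 0)) as H1 by (apply rec_nth; lia).
  repeat apply rec_ifeq; auto 20 using rec_const, rec_cfst, rec_csnd, rec_cpair, rec_add,
    rec_lookup, rec_sub, rec_S, rec_if0, rec_rel_code.
  apply (rec_inst_code 2 _ [(fun v => shift I + cfst (csnd (nth 0 v 0)));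
                            (fun v => shift I + csnd (csnd (nth 0 v 0)))]).
  intros g' [<-|[<-|[]]]; auto 20 using rec_const, rec_cfst, rec_csnd, rec_add.
Qed.

(* Numbers that are not codes of formulas are mapped to codes of ill-formed
   formulas, so the reduction need not recognize sentences. *)
Definition code_trans (s' : signature) (I : interpretation) (n : nat) (q : form) : Prop :=
  (exists p, n = enc p /\ q = trans s' I p) \/ ((forall p, enc p <> n) /\ ~ wf s' q).

Lemma code_trans_binary s' I tag (C : form -> form -> form) b1 b2 q1 q2 :
  (forall p q, enc (C p q) = cpair tag (cpair (enc p) (enc q))) ->
  (forall p q, trans s' I (C p q) = C (trans s' I p) (trans s' I q)) ->
  (forall p q, wf s' (C p q) -> wf s' p /\ wf s' q) ->
  (forall r x y, enc r = cpair tag (cpair x y) -> exists p q, enc p = x /\ enc q = y) ->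
  code_trans s' I b1 q1 -> code_trans s' I b2 q2 ->
  code_trans s' I (cpair tag (cpair b1 b2)) (C q1 q2).
Proof.
  intros Ec Et Wc Inv [(p1 & -> & ->)|[N1 W1]] [(p2 & -> & ->)|[N2 W2]];
    [left; exists (C p1 p2); now rewrite Ec, Et|right; split..];
    try (intros r (p & q & E1 & E2)%Inv; try (now apply N1 in E1); now apply N2 in E2);
    now intros []%Wc.
Qed.

Lemma code_trans_quantifier s' I tag (C : nat -> form -> form) x b q :
  (forall y p, enc (C y p) = cpair tag (cpair y (enc p))) ->
  (forall y p, trans s' I (C y p) = C (shift I + y) (trans s' I p)) ->
  (forall y p, wf s' (C y p) -> wf s' p) ->
  (forall r y z, enc r = cpair tag (cpair y z) -> exists p, enc p = z) ->
  code_trans s' I b q ->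
  code_trans s' I (cpair tag (cpair x b)) (C (shift I + x) q).
Proof.
  intros Ec Et Wc Inv [(p & -> & ->)|[N W]];
    [left; exists (C x p); now rewrite Ec, Et|right; split].
  - intros r (p & E)%Inv; now apply N in E.
  - now intros ?%Wc.
Qed.

(** Used both to show that a number is not the code of a formula and to invert an equation between
    codes with a known tag. *)
Ltac not_enc :=
  let r := fresh "r" in
  intros r; destruct r; cbn [enc]; intros; try (lazymatch goal with |- _ <> _ => intro end);
  repeat match goal with
    | H : cpair _ _ = cpair _ _ |- _ => apply cpair_inj in H as [? H]
    end; try discriminate; eauto.

Lemma trans_codeE s' I n : exists q, trans_code s' I n = enc q /\
  code_trans s' I n q.
Proof.
  induction n as [n IH] using lt_wf_ind.
  assert (forall m, m < n -> lookup (n - S m) (hist (trans_step s' I) n) = trans_code s' I m)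
    as Hl by (intros; now apply lookup_hist).
  change (trans_code s' I n) with (trans_step s' I n (hist (trans_step s' I) n)).
  revert Hl; generalize (hist (trans_step s' I) n) as h; intros h Hl; unfold trans_step.
  remember (cfst n) as a eqn:Ea; remember (csnd n) as b eqn:Eb.
  assert (n = cpair a b) as En by (subst; now rewrite cpair_surj).
  (* For tag 0 the bound can fail, as at [n = 0], but that case reads no earlier value. *)
  assert (a = 0 \/ b < n) as Lb.
  { destruct a; [now left|right; subst n; apply lt_cpair_r]. }
  remember (cfst b) as b1 eqn:Eb1; remember (csnd b) as b2 eqn:Eb2.
  assert (b = cpair b1 b2) as Eb' by (subst; now rewrite cpair_surj).
  assert (b1 <= b /\ b2 <= b) as [L1 L2] by (rewrite Eb'; auto using le_cpair_l, le_cpair_r).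
  clear Ea Eb Eb1 Eb2; pose proof (bad_not_wf s') as B.
  unfold ifeq.
  destruct a as [|[|[|[|[|[|[|[|[|a]]]]]]]]]; cbn [Nat.eqb];
    [ | | |destruct Lb as [|Lb]; [easy|]; rewrite !Hl by lia ..|].
  - exists (trans s' I (FEq b1 b2)); split; [cbn [trans]; now rewrite inst_codeE|].
    left; exists (FEq b1 b2); now subst.
  - destruct (enc_list_surj b2) as [l El].
    exists (trans s' I (FRel b1 l)); rewrite <- El; split; [apply rel_codeE|].
    left; exists (FRel b1 l); now subst.
  - destruct b as [|b]; cbn [if0].
    + exists FFalse; split; [easy|left; now exists FFalse].
    + exists (bad s'); split; [easy|right; subst n; split; [not_enc|easy]].
  - destruct (IH b Lb) as (q & -> & Hq); exists (FNot q); split; [easy|].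
    destruct Hq as [(p & -> & ->)|[N W]]; [left; now exists (FNot p)|right].
    subst n; split; [not_enc; now apply (N r)|easy].
  - destruct (IH b1 ltac:(lia)) as (q1 & -> & H1), (IH b2 ltac:(lia)) as (q2 & -> & H2).
    exists (FAnd q1 q2); split; [easy|rewrite En, Eb'].
    apply code_trans_binary; auto; not_enc.
  - destruct (IH b1 ltac:(lia)) as (q1 & -> & H1), (IH b2 ltac:(lia)) as (q2 & -> & H2).
    exists (FOr q1 q2); split; [easy|rewrite En, Eb'].
    apply code_trans_binary; auto; not_enc.
  - destruct (IH b1 ltac:(lia)) as (q1 & -> & H1), (IH b2 ltac:(lia)) as (q2 & -> & H2).
    exists (FImp q1 q2); split; [easy|rewrite En, Eb'].
    apply code_trans_binary; auto; not_enc.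
  - destruct (IH b2 ltac:(lia)) as (q & -> & H).
    exists (FAll (shift I + b1) q); split; [easy|rewrite En, Eb'].
    apply code_trans_quantifier; auto; not_enc.
  - destruct (IH b2 ltac:(lia)) as (q & -> & H).
    exists (FEx (shift I + b1) q); split; [easy|rewrite En, Eb'].
    apply code_trans_quantifier; auto; not_enc.
  - exists (bad s'); split; [easy|right; subst n; split; [not_enc|easy]].
Qed.

Lemma trans_mreducible s s' I M N :
  wf_interpretation s' I -> s = map fst (rels I) -> interpretation_of I M N ->
  mreducible (codes (FO s M)) (codes (FO s' N)).
Proof.
  intros WI Hs HI.
  (* The prefix put in front of the translation is fixed, so on codes it is a composition of
     pairings with constants. *)
  assert (exists w, (forall k g, rec k g -> rec k (fun v => w (g v))) /\
    forall p, w (enc p) = enc (alls (npar I) (FImp (good I) p))) as (w & Rw & Ew).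
  { induction (npar I) as [|m (w & Rw & Ew)].
    - exists (fun z => cpair 6 (cpair (enc (good I)) z)); split; [|easy].
      auto using rec_cpair, rec_const.
    - exists (fun z => cpair 7 (cpair m (w z))); split.
      + auto 10 using rec_cpair, rec_const.
      + intros p; now rewrite Ew. }
  exists (fun n => w (trans_code s' I n)); split.
  { apply rec_computable, Rw, rec_trans_code, rec_nth; lia. }
  intros n; destruct (trans_codeE s' I n) as (q & -> & H); rewrite Ew.
  destruct H as [(p & -> & ->)|[Nc W]].
  - fold (trans_sentence s' I p); split; intros (p' & Hp & E%enc_inj); subst p'.
    + exists (trans_sentence s' I p); split; [now apply (FO_trans s s' I WI Hs M N)|easy].
    + exists p; split; [now apply (FO_trans s s' I WI Hs M N) in Hp|easy].
  - split.
    + intros (p & _ & E); now apply Nc in E.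
    + intros (p & (Wp & _) & E%enc_inj); subst p.
      apply wf_alls in Wp; now destruct Wp.
Qed.

(** * The lattice of open sets in second-order arithmetic *)

(** A pairing without division, hence expressible by one addition, one multiplication and another
    addition. It is injective because [b] is at most [a + b], less than the gap between consecutive
    squares. *)
Definition pr (a b : nat) : nat := (a + b) * (a + b) + b.

Lemma pr_inj a b c d : pr a b = pr c d -> a = c /\ b = d.
Proof.
  unfold pr; intros E; destruct (lt_eq_lt_dec (a + b) (c + d)) as [[L|L]|L]; nia.
Qed.

(** Numbers are read as the empty set, so that every element of [N2] represents an open set. *)
Definition setpart (d : N2_dom) : nat -> Prop :=
  match d with inl _ => fun _ => False | inr A => A end.

Definition pr_form (x y z : nat) : form :=
  FEx 20 (FEx 21 (FAnd (FRel 3 [x; y; 20]) (FAnd (FRel 4 [20; 20; 21]) (FRel 3 [21; y; z])))).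

Lemma sat_pr (rho : nat -> N2_dom) x y z : x < 20 -> y < 20 -> z < 20 ->
  sat N2 rho (pr_form x y z) <->
  exists a b, rho x = inl a /\ rho y = inl b /\ rho z = inl (pr a b).
Proof.
  intros Lx Ly Lz; cbn -[Nat.add Nat.mul].
  assert (forall d d', upd (upd rho 20 d) 21 d' x = rho x) as Ex
    by (intros; rewrite !upd_neq; lia || easy).
  assert (forall d d', upd (upd rho 20 d) 21 d' y = rho y) as Ey
    by (intros; rewrite !upd_neq; lia || easy).
  assert (forall d d', upd (upd rho 20 d) 21 d' z = rho z) as Ez
    by (intros; rewrite !upd_neq; lia || easy).
  split.
  - intros (d & d' & H); rewrite Ex, Ey, Ez in H; unfold upd in H; cbn -[Nat.add Nat.mul] in H.
    destruct (rho x) as [a|]; [|easy]; destruct (rho y) as [b|]; [|easy].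
    destruct d as [d|]; [|easy]; destruct d' as [d'|]; [|easy].
    destruct (rho z) as [c|]; [|easy].
    exists a, b; repeat split; unfold pr; f_equal; destruct H as (<- & <- & <-); easy.
  - intros (a & b & Ha & Hb & Hc); exists (inl (a + b)), (inl ((a + b) * (a + b))).
    rewrite Ex, Ey, Ez, Ha, Hb, Hc; unfold upd; cbn -[Nat.add Nat.mul]; now unfold pr.
Qed.

(* The variable [0] is the parameter coding the enumeration. *)
Definition mem_form (x y : nat) : form := FEx 19 (FAnd (pr_form x y 19) (FRel 2 [19; 0])).

Lemma sat_mem (rho : nat -> N2_dom) x y : x < 19 -> y < 19 ->
  sat N2 rho (mem_form x y) <->
  exists a b, rho x = inl a /\ rho y = inl b /\ setpart (rho 0) (pr a b).
Proof.
  intros Lx Ly; unfold mem_form; cbn [sat].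
  assert (forall d, sat N2 (upd rho 19 d) (pr_form x y 19) <->
     exists a b, rho x = inl a /\ rho y = inl b /\ d = inl (pr a b)) as E.
  { intros d; rewrite sat_pr by lia; rewrite upd_eq, !upd_neq by lia; tauto. }
  split.
  - intros (d & H & Hg); apply E in H; destruct H as (a & b & Ha & Hb & ->).
    exists a, b; repeat split; auto; cbn in Hg; now destruct (rho 0).
  - intros (a & b & Ha & Hb & Hg); exists (inl (pr a b)); rewrite E; split; [eauto|].
    cbn -[pr]; now destruct (rho 0).
Qed.

(* The atoms [a] are the basic open sets [mem^-1 a]; by [base], the point given
   by [point] is the least point of the basic open set of [F]. *)
Record presentation (X : subbased_space) := {
  mem : pt X -> nat -> Prop;
  valid : nat -> Prop;
  ok : nat -> nat -> Prop;
  mem_open : forall a, is_open X (fun x => mem x a);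
  mem_valid : forall x a, mem x a -> valid a;
  mem_ok : forall x a b, mem x a -> mem x b -> ok a b;
  ok_refl : forall a, valid a -> ok a a;
  ok_sym : forall a b, ok a b -> ok b a;
  point : forall F, (forall a, In a F -> valid a) -> (forall a b, In a F -> In b F -> ok a b) ->
    exists p, forall a, mem p a <-> In a F;
  base : forall V x, is_open X V -> V x ->
    exists F, (forall a, In a F -> mem x a) /\ forall y, (forall a, In a F -> mem y a) -> V y
}.
Arguments mem {X}. Arguments valid {X}. Arguments ok {X}.

(** Variables 2 and 3 are the ones that [lattice_good] quantifies around these formulas, which can
    thus be inserted without substitution. *)
Definition defines_unary (p : form) (P : nat -> Prop) : Prop :=
  wf sig_N2 p /\ (forall x, free_in x p -> x = 2) /\
  forall (rho : nat -> N2_dom) a, rho 2 = inl a -> sat N2 rho p <-> P a.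

Definition defines_binary (p : form) (P : nat -> nat -> Prop) : Prop :=
  wf sig_N2 p /\ (forall x, free_in x p -> x = 2 \/ x = 3) /\
  forall (rho : nat -> N2_dom) a b, rho 2 = inl a -> rho 3 = inl b -> sat N2 rho p <-> P a b.

Lemma open_ext (X : subbased_space) (U V : Sigma01 X) :
  (forall x, proj1_sig U x <-> proj1_sig V x) -> U = V.
Proof.
  destruct U as [U HU], V as [V HV]; cbn; intros E.
  assert (U = V) as <- by (extensionality x; now apply propositional_extensionality).
  f_equal; apply proof_irrelevance.
Qed.

Lemma open_union (X : subbased_space) {J} (P : J -> Prop) (U : J -> pt X -> Prop) :
  (forall j, P j -> is_open X (U j)) -> is_open X (fun x => exists j, P j /\ U j x).
Proof.
  intros H x (j & Pj & Hx); destruct (H j Pj x Hx) as (Bs & H1 & H2 & H3).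
  exists Bs; repeat split; eauto.
Qed.

Lemma open_inter (X : subbased_space) (U V : pt X -> Prop) :
  is_open X U -> is_open X V -> is_open X (fun x => U x /\ V x).
Proof.
  intros HU HV x [Hu Hv].
  destruct (HU x Hu) as (Bs & H1 & H2 & H3), (HV x Hv) as (Cs & K1 & K2 & K3).
  exists (Bs ++ Cs); repeat split.
  - intros B [H|H]%in_app_iff; auto.
  - intros B [H|H]%in_app_iff; [exact (H2 B H)|exact (K2 B H)].
  - apply H3; intros B HB; apply H, in_app_iff; auto.
  - apply K3; intros B HB; apply H, in_app_iff; auto.
Qed.

Lemma open_inter_list (X : subbased_space) {J} (U : J -> pt X -> Prop) (F : list J) :
  (forall j, In j F -> is_open X (U j)) -> is_open X (fun x => forall j, In j F -> U j x).
Proof.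
  induction F as [|j F IH]; intros H.
  - intros x _; exists []; split; [easy|split; [easy|intros y _ j []]].
  - intros x Hx.
    assert (is_open X (fun x => U j x /\ forall j, In j F -> U j x)) as O.
    { apply open_inter; [apply H; now left|apply IH; intros; apply H; now right]. }
    destruct (O x) as (Bs & H1 & H2 & H3).
    { split; [apply Hx; now left|intros; apply Hx; now right]. }
    exists Bs; repeat split; auto.
    intros y Hy; destruct (H3 y Hy); intros i [<-|]; auto.
Qed.

Lemma bounded_finite (P : nat -> Prop) m :
  (forall a, P a -> a <= m) -> exists F, forall a, In a F <-> P a.
Proof.
  intros H.
  assert (forall n, exists F, forall a, In a F <-> P a /\ a < n) as Hn.
  { induction n as [|n (F & HF)].
    - exists []; firstorder lia.
    - destruct (classic (P n)) as [Pn|Pn].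
      + exists (n :: F); intros a; cbn; rewrite HF.
        destruct (Nat.eq_dec a n); [subst|]; intuition lia.
      + exists F; intros a; rewrite HF.
        destruct (Nat.eq_dec a n); [subst|]; intuition lia. }
  destruct (Hn (S m)) as [F HF]; exists F; intros a; rewrite HF.
  split; [easy|]; intros Pa; specialize (H a Pa); auto with arith.
Qed.

(* [E e] runs over all finite consistent sets of atoms. *)
Definition enumerates {X} (PX : presentation X) (E : nat -> nat -> Prop) : Prop :=
  (exists e, forall a, ~ E e a) /\
  (forall e a, E e a -> valid PX a) /\
  (forall e a b, E e a -> E e b -> ok PX a b) /\
  (forall e, exists m, forall a, E e a -> exists t, a + t = m) /\
  (forall e a, valid PX a -> (forall b, E e b -> ok PX a b) ->
     exists e', forall b, E e' b <-> E e b \/ b = a).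

(** The clauses of [enumerates] in order. Finiteness is boundedness, with the order written by
    addition; exhaustiveness is the presence of the empty set together with closure under adjoining
    a consistent atom. [FRel 0] restricts to numbers where a set would satisfy or break a clause by
    accident. *)
Definition lattice_good (vf okf : form) : form :=
  FAnd (FEx 1 (FAnd (FRel 0 [1]) (FAll 2 (FNot (mem_form 1 2)))))
  (FAnd (FAll 1 (FAll 2 (FImp (mem_form 1 2) vf)))
  (FAnd (FAll 1 (FAll 2 (FAll 3 (FImp (FAnd (mem_form 1 2) (mem_form 1 3)) okf))))
  (FAnd (FAll 1 (FEx 4 (FAll 2 (FImp (mem_form 1 2) (FEx 5 (FRel 3 [2; 5; 4]))))))
  (FAll 1 (FAll 2 (FImp (FAnd (FAnd (FRel 0 [1]) (FRel 0 [2]))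
                              (FAnd vf (FAll 3 (FImp (mem_form 1 3) okf))))
     (FEx 4 (FAll 3 (FAnd (FImp (mem_form 4 3) (FOr (mem_form 1 3) (FEq 3 2)))
                          (FImp (FOr (mem_form 1 3) (FEq 3 2)) (mem_form 4 3))))))))))).

(** The innermost inclusion is reversed because more atoms give a smaller basic open set. *)
Definition lattice_le (x y : nat) : form :=
  FAll 3 (FImp (FRel 2 [3; x])
    (FEx 4 (FAnd (FRel 2 [4; y]) (FAll 5 (FImp (mem_form 4 5) (mem_form 3 5)))))).

Definition lattice_in_N2 (vf okf : form) : interpretation := {|
  npar := 1; shift := 3;
  eqf := FAnd (lattice_le 1 2) (lattice_le 2 1);
  rels := [(2, lattice_le 1 2)];
  good := lattice_good vf okf
|}.

Lemma sat_lattice_good {X} (PX : presentation X) vf okf (rho : nat -> N2_dom) :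
  defines_unary vf (valid PX) -> defines_binary okf (ok PX) ->
  sat N2 rho (lattice_good vf okf) <->
  enumerates PX (fun e a => setpart (rho 0) (pr e a)).
Proof.
  intros (_ & _ & Sv) (_ & _ & So).
  assert (forall (rho : nat -> N2_dom) x y a b,
    x < 19 -> y < 19 -> rho x = inl a -> rho y = inl b ->
    sat N2 rho (mem_form x y) <-> setpart (rho 0) (pr a b)) as Sm.
  { intros rho' x y a b Lx Ly Hx Hy; rewrite sat_mem, Hx, Hy by easy; split; [|eauto].
    intros (? & ? & [= <-] & [= <-] & H); easy. }
  unfold lattice_good, enumerates; cbn [sat]; split; intros (H1 & H2 & H3 & H4 & H5);
    (split; [|split; [|split; [|split]]]).
  - destruct H1 as ([e|] & He & H); [|easy].
    exists e; intros a Ha; apply (H (inl a)); now rewrite (Sm _ 1 2 e a) by (easy || lia).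
  - intros e a Ha; apply (Sv (upd (upd rho 1 (inl e)) 2 (inl a)) a eq_refl), H2.
    now rewrite (Sm _ 1 2 e a) by (easy || lia).
  - intros e a b Ha Hb.
    apply (So (upd (upd (upd rho 1 (inl e)) 2 (inl a)) 3 (inl b)) a b eq_refl eq_refl), H3.
    now rewrite (Sm _ 1 2 e a), (Sm _ 1 3 e b) by (easy || lia).
  - intros e; destruct (H4 (inl e)) as ([m|] & H).
    + exists m; intros a Ha; destruct (H (inl a)) as ([t|] & Ht); [|now exists t|easy].
      now rewrite (Sm _ 1 2 e a) by (easy || lia).
    (* If the bound found is a set, addition never holds, so [E e] is empty and 0 bounds it. *)
    + exists 0; intros a Ha; destruct (H (inl a)) as ([t|] & Ht); [|easy|easy].
      now rewrite (Sm _ 1 2 e a) by (easy || lia).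
  - intros e a Va Ho; destruct (H5 (inl e) (inl a)) as (d & H).
    + split; [easy|split; [now apply Sv with a|]].
      intros [b|] Hb; [|apply sat_mem in Hb as (? & ? & _ & ? & _); [easy|lia|lia]].
      apply So with a b; [easy|easy|apply Ho].
      now rewrite (Sm _ 1 3 e b) in Hb by (easy || lia).
    (* The adjoined atom [a] is an element of the new set, and only numbers have elements under
       [mem_form]. *)
    + assert (exists e', d = inl e') as [e' ->].
      { destruct (H (inl a)) as [_ H'].
        specialize (H' (or_intror eq_refl)); apply sat_mem in H' as (e' & _ & E & _); [|lia|lia].
        now exists e'. }
      exists e'; intros b; destruct (H (inl b)) as [K1 K2].
      rewrite (Sm _ 4 3 e' b), (Sm _ 1 3 e b) in K1, K2 by (easy || lia).
      cbn -[pr] in K1, K2; split.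
      * intros Hb; destruct (K1 Hb) as [|[= ->]]; auto.
      * intros [Hb| ->]; apply K2; auto.
  - destruct H1 as [e H]; exists (inl e); split; [easy|].
    intros [a|] Ha; [|apply sat_mem in Ha as (? & ? & _ & ? & _); [easy|lia|lia]].
    rewrite (Sm _ 1 2 e a) in Ha by (easy || lia); now apply (H a).
  - intros d d' Ha; apply sat_mem in Ha as (e & a & Ed & Ea & Ha); [|lia|lia].
    apply (Sv _ a Ea), (H2 e), Ha.
  - intros d d' d'' [Ha Hb]; apply sat_mem in Ha as (e & a & Ed & Ea & Ha); [|lia|lia].
    apply sat_mem in Hb as (e' & b & Ee & Eb & Hb); [|lia|lia].
    cbn in Ed, Ee; rewrite Ed in Ee; injection Ee as <-.
    apply (So _ a b Ea Eb), (H3 e); easy.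
  - intros [e|A]; [destruct (H4 e) as [m H]; exists (inl m)|exists (inl 0)]; intros d Ha.
    + apply sat_mem in Ha as (e' & a & [= <-] & Ea & Ha); [|lia|lia].
      destruct (H a Ha) as [t Ht]; exists (inl t); cbn in Ea; subst d; exact Ht.
    + now apply sat_mem in Ha as (e' & a & ? & _); [|lia|lia].
  - intros [e|] [a|] [[He Ha] [Va Ho]]; try easy.
    apply (Sv _ a eq_refl) in Va; destruct (H5 e a Va) as [e' H].
    { intros b Hb.
      apply (So (upd (upd (upd rho 1 (inl e)) 2 (inl a)) 3 (inl b)) a b eq_refl eq_refl), Ho.
      now rewrite (Sm _ 1 3 e b) by (easy || lia). }
    exists (inl e'); intros d; split.
    + intros Hb; apply sat_mem in Hb as (? & b & [= <-] & Eb & Hb); [|lia|lia].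
      rewrite (Sm _ 1 3 e b) by (easy || lia); cbn in Eb; subst d; cbn -[pr] in Hb |- *.
      apply H in Hb as [|<-]; auto.
    + intros [Hb|Eb].
      * apply sat_mem in Hb as (? & b & [= <-] & Eb & Hb); [|lia|lia].
        rewrite (Sm _ 4 3 e' b) by (easy || lia); cbn -[pr]; rewrite H; now left.
      * cbn in Eb; subst d; rewrite (Sm _ 4 3 e' a) by (easy || lia); cbn -[pr]; rewrite H; auto.
Qed.

Lemma wf_lattice_in_N2 {X} (PX : presentation X) vf okf :
  defines_unary vf (valid PX) -> defines_binary okf (ok PX) ->
  wf_interpretation sig_N2 (lattice_in_N2 vf okf).
Proof.
  intros (Wv & Fv & _) (Wo & Fo & _); split; cbn.
  - intuition.
  - intros n t [[= <- <-]|[]]; cbn; intuition.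
  - intuition.
  - intuition lia.
  - intros n t x [[= <- <-]|[]]; cbn; intuition lia.
  - intros x H.
    assert (free_in x vf -> x <> 2 -> x < 1) by (intros H' ?; apply Fv in H'; lia).
    assert (free_in x okf -> x <> 2 -> x <> 3 -> x < 1)
      by (intros H' ? ?; apply Fo in H'; lia).
    intuition lia.
  - lia.
  - intros n t [[= <- <-]|[]]; lia.
Qed.

Section LatticeInN2.
Context {X : subbased_space} (PX : presentation X).

Definition basic (P : nat -> Prop) (x : pt X) : Prop := forall a, P a -> mem PX x a.

Context (E : nat -> nat -> Prop) (HE : enumerates PX E).

Lemma enum_list e : exists F, forall a, In a F <-> E e a.
Proof.
  destruct HE as (_ & _ & _ & H & _); destruct (H e) as [m Hm].
  apply (bounded_finite _ m); intros a Ha; destruct (Hm a Ha); lia.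
Qed.

Lemma enum_point e : exists p, forall a, mem PX p a <-> E e a.
Proof.
  destruct (enum_list e) as [F HF], HE as (_ & Hv & Ho & _).
  destruct (point _ PX F) as [p Hp].
  - intros a; rewrite HF; apply Hv.
  - intros a b; rewrite !HF; apply Ho.
  - exists p; intros a; now rewrite Hp.
Qed.

Lemma enum_surj F : (forall a, In a F -> valid PX a) ->
  (forall a b, In a F -> In b F -> ok PX a b) -> exists e, forall a, E e a <-> In a F.
Proof.
  destruct HE as (H1 & _ & _ & _ & H5).
  induction F as [|a F IH]; intros V O.
  - destruct H1 as [e H]; exists e; firstorder.
  - destruct IH as [e He]; [intros; apply V; now right|intros; apply O; now right|].
    destruct (H5 e a) as [e' He'].
    + apply V; now left.
    + intros b Hb%He; apply O; cbn; auto.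
    + exists e'; intros b; rewrite He', He; cbn; intuition.
Qed.

Lemma basic_open e : is_open X (basic (E e)).
Proof.
  destruct (enum_list e) as [F HF]; unfold is_open; intros x Hx.
  destruct (open_inter_list X (fun a y => mem PX y a) F) with (x := x) as (Bs & H1 & H2 & H3).
  - intros; apply mem_open.
  - intros a Ha; now apply Hx, HF.
  - exists Bs; repeat split; auto; intros y Hy a Ha; apply H3; auto; now apply HF.
Qed.

Definition union_of (A : nat -> Prop) : Sigma01 X :=
  exist _ (fun x => exists e, A e /\ basic (E e) x)
    (open_union X A (fun e => basic (E e)) (fun e _ => basic_open e)).

Lemma union_of_surj U : exists A, union_of A = U.
Proof.
  exists (fun e => forall x, basic (E e) x -> proj1_sig U x); apply open_ext; intros x; cbn; split.
  - intros (e & H & Hx); auto.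
  - intros Hx; destruct (base _ PX _ _ (proj2_sig U) Hx) as (F & HF & HU).
    destruct (enum_surj F) as [e He].
    + intros; eapply mem_valid; eauto.
    + intros; eapply mem_ok; eauto.
    + exists e; split; [intros y Hy; apply HU; intros a Ha; apply Hy, He, Ha|].
      intros a Ha; apply HF, He, Ha.
Qed.

(** From left to right the inclusion is tested at the least point of [basic (E e)], whose atoms are
    exactly those of [E e]. *)
Lemma union_of_le A B :
  (forall x, proj1_sig (union_of A) x -> proj1_sig (union_of B) x) <->
  (forall e, A e -> exists e', B e' /\ forall a, E e' a -> E e a).
Proof.
  cbn; split.
  - intros H e He; destruct (enum_point e) as [p Hp].
    destruct (H p) as (e' & He' & H').
    + exists e; split; [easy|]; intros a; apply Hp.
    + exists e'; split; [easy|]; intros a Ha; apply Hp; auto.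
  - intros H x (e & He & Hx); destruct (H e He) as (e' & He' & H').
    exists e'; split; [easy|]; intros a Ha; auto.
Qed.

End LatticeInN2.

Lemma sat_lattice_le (rho : nat -> N2_dom) x y : x < 3 -> y < 3 ->
  let E e a := setpart (rho 0) (pr e a) in
  sat N2 rho (lattice_le x y) <->
  forall e, setpart (rho x) e ->
    exists e', setpart (rho y) e' /\ forall a, E e' a -> E e a.
Proof.
  intros Lx Ly E; unfold lattice_le; cbn [sat].
  assert (forall d, upd rho 3 d x = rho x) as Ex by (intros; apply upd_neq; lia).
  assert (forall d d', upd (upd rho 3 d) 4 d' y = rho y) as Ey
    by (intros; rewrite !upd_neq; lia || easy).
  assert (forall d e, N2_interp 2 [d; e] <-> exists n, d = inl n /\ setpart e n) as E2.
  { intros [n|] [m|A]; cbn; split; try easy; try (intros (? & [= <-] & ?); easy); intros H; eauto. }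
  assert (forall e e',
      (forall d, sat N2 (upd (upd (upd rho 3 (inl e)) 4 (inl e')) 5 d) (mem_form 4 5) ->
      sat N2 (upd (upd (upd rho 3 (inl e)) 4 (inl e')) 5 d) (mem_form 3 5)) <->
      forall a, E e' a -> E e a) as Em.
  { intros e e'; split.
    - intros H a Ha; specialize (H (inl a)); rewrite !sat_mem in H by lia.
      destruct H as (? & ? & [= <-] & [= <-] & H); [now exists e', a|easy].
    - intros H d; rewrite !sat_mem by lia; intros (? & a & [= <-] & Ed & Ha).
      exists e, a; repeat split; auto; now apply H. }
  cbn [interp N2 map]; split.
  - intros H e He; destruct (H (inl e)) as (d & H1 & H2).
    + apply E2; exists e; now rewrite Ex.
    + apply E2 in H1 as (e' & Hd & H1); rewrite Ey in H1; cbn in Hd; subst d.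
      exists e'; split; [easy|now apply Em].
  - intros H d Hd; apply E2 in Hd as (e & Hd & He); rewrite Ex in He; cbn in Hd; subst d.
    destruct (H e He) as (e' & H1 & H2); exists (inl e'); split; [|now apply Em].
    apply E2; exists e'; now rewrite Ey.
Qed.

(** The index [enc_list F] enumerates [F] if that list is consistent; all other indices enumerate
    the empty set. Being the value of a parameter, the set may be described outside arithmetic. *)
Lemma enumeration_exists {X} (PX : presentation X) :
  exists g : nat -> Prop, enumerates PX (fun e a => g (pr e a)).
Proof.
  set (cons F := (forall a, In a F -> valid PX a) /\
                 (forall a b, In a F -> In b F -> ok PX a b)).
  exists (fun c => exists F a, c = pr (enc_list F) a /\ cons F /\ In a F).
  assert (forall F, cons F -> forall b,
    (exists F' a, pr (enc_list F) b = pr (enc_list F') a /\ cons F' /\ In a F') <-> In b F) as Eq.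
  { intros F HF b; split; [|intros Hb; now exists F, b].
    intros (F' & a & [E <-]%pr_inj & _ & H); now apply enc_list_inj in E as <-. }
  split; [|split; [|split; [|split]]].
  - exists (enc_list []); intros a H; now apply Eq in H.
  - intros e a (F & b & [_ <-]%pr_inj & [H _] & Hb); auto.
  - intros e a b (F & a' & [-> <-]%pr_inj & HF & Ha) Hb; apply Eq in Hb; [|easy].
    now apply HF.
  - intros e; destruct (enc_list_surj e) as [F <-]; exists (list_max F).
    intros a (F' & b & [->%enc_list_inj <-]%pr_inj & _ & Ha).
    assert (a <= list_max F') as L.
    { pose proof (proj1 (list_max_le F' _) (le_n _)) as H; rewrite Forall_forall in H; auto. }
    exists (list_max F' - a); lia.
  - intros e a Va Ho.
    assert (exists F, cons F /\ forall b,
      (exists F' c, pr e b = pr (enc_list F') c /\ cons F' /\ In c F') <-> In b F) as (F & HF & EF).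
    { destruct (classic (exists F, e = enc_list F /\ cons F)) as [(F & -> & HF)|N].
      - exists F; auto.
      - exists []; split; [easy|]; intros b; split; [|easy].
        intros (F' & c & [-> _]%pr_inj & H & _); now apply N; exists F'. }
    assert (cons (a :: F)) as Hc.
    { split; [intros b [<-|]; [easy|now apply HF]|].
      intros b c [<-|Hb] [<-|Hc].
      - now apply ok_refl.
      - now apply Ho, EF.
      - now apply ok_sym, Ho, EF.
      - now apply HF. }
    exists (enc_list (a :: F)); intros b; rewrite Eq, EF by easy; cbn; intuition.
Qed.

Lemma lattice_in_N2_correct {X} (PX : presentation X) vf okf :
  defines_unary vf (valid PX) -> defines_binary okf (ok PX) ->
  interpretation_of (lattice_in_N2 vf okf) (Sigma01_str X) N2.
Proof.
  intros Dv Do; split; cbn [npar lattice_in_N2 eqf rels good].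
  - destruct (enumeration_exists PX) as [g Hg]; exists (fun _ => inr g).
    now apply (sat_lattice_good PX).
  - intros rho Hg; apply (sat_lattice_good PX) in Hg; [|easy|easy].
    exists (fun d => union_of PX _ Hg (setpart d)); split.
    + intros U; destruct (union_of_surj PX _ Hg U) as [A <-]; now exists (inr A).
    + intros rho' Ag; specialize (Ag 0 Nat.lt_0_1).
      assert (forall x y, x < 3 -> y < 3 -> sat N2 rho' (lattice_le x y) <->
        forall p, proj1_sig (union_of PX _ Hg (setpart (rho' x))) p ->
                  proj1_sig (union_of PX _ Hg (setpart (rho' y))) p) as L.
      { intros x y Lx Ly; rewrite sat_lattice_le, union_of_le, Ag by easy; tauto. }
      split.
      * cbn [sat]; rewrite !L by lia; split.
        -- intros [H1 H2]; apply open_ext; intros x; split; auto.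
        -- intros ->; auto.
      * intros [|[|r]] n t [= <- <-]; apply L; lia.
Qed.

(** * Second-order arithmetic in the lattice of open sets *)

Section Order.
Context {L : Type} (le : L -> L -> Prop).

(* In a lattice of open sets these are the sets with a least point in the
   specialization order, i.e. the completely join-prime elements. *)
Definition prime (d : L) : Prop :=
  exists c, (le c d /\ ~ le d c) /\ forall e, le e d /\ ~ le d e -> le e c.

(** An antichain of primes is recovered from its union as the maximal primes below it, so one
    lattice element stands for a set of lattice elements. *)
Definition max_prime (n d : L) : Prop :=
  prime d /\ le d n /\ forall e, prime e /\ le e n /\ le d e -> le e d.

(* [a0], [a1], [a2] split a number into three components, so that a set of
   finite sets, one component from each of three numbers, is a ternary relation. *)
Definition coded (a0 a1 a2 p x y z : L) : Prop :=
  exists a, (max_prime a0 a /\ le x a) /\ exists b, (max_prime a1 b /\ le y b) /\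
  exists c, (max_prime a2 c /\ le z c) /\
    forall u, le u a /\ le u b /\ le u c -> le u p.

(** The second-order Peano axioms with graphs for the operations and [PL x one] for the successor.
    Induction is stated for the set of numbers below an arbitrary element [u]. The quantifiers are
    guarded one at a time to match [arithmetic_form] clause by clause. *)
Definition arithmetic (num : L -> Prop) (PL TI : L -> L -> L -> Prop) (o one : L) : Prop :=
  (num o /\ num one) /\
  (forall x, num x -> forall y, num y -> exists z, num z /\ PL x y z) /\
  (forall x, num x -> forall y, num y -> exists z, num z /\ TI x y z) /\
  (forall x, num x -> forall y, num y -> forall z, num z -> forall z', num z' ->
     PL x y z /\ PL x y z' -> z = z') /\
  (forall x, num x -> forall y, num y -> forall z, num z -> forall z', num z' ->
     TI x y z /\ TI x y z' -> z = z') /\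
  (forall x, num x -> PL x o x) /\
  (forall x, num x -> forall y, num y -> forall y', num y' -> forall z, num z ->
     forall z', num z' -> PL y one y' /\ PL x y z /\ PL z one z' -> PL x y' z') /\
  (forall x, num x -> TI x o o) /\
  (forall x, num x -> forall y, num y -> forall y', num y' -> forall z, num z ->
     forall z', num z' -> PL y one y' /\ TI x y z /\ PL z x z' -> TI x y' z') /\
  (forall x, num x -> ~ PL x one o) /\
  (forall x, num x -> forall y, num y -> forall z, num z -> PL x one z /\ PL y one z -> x = y) /\
  (forall u, le o u /\ (forall x, num x -> forall y, num y -> le x u /\ PL x one y -> le y u) ->
     forall x, num x -> le x u).

End Order.

Lemma arithmetic_std {L} (le : L -> L -> Prop) num PL TI (nu : nat -> L) :
  (forall m n, nu m = nu n -> m = n) ->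
  (forall d, num d <-> exists n, d = nu n) ->
  (forall a b c, PL (nu a) (nu b) (nu c) <-> c = a + b) ->
  (forall a b c, TI (nu a) (nu b) (nu c) <-> c = a * b) ->
  arithmetic le num PL TI (nu 0) (nu 1).
Proof.
  intros Inj Num HP HT.
  assert (forall P : L -> Prop, (forall n, P (nu n)) -> forall d, num d -> P d) as All.
  { intros P H d Hd; apply Num in Hd as [n ->]; auto. }
  assert (forall n, num (nu n)) as Nn by (intros; apply Num; eauto).
  repeat split; auto.
  - apply (All (fun x => forall y, num y -> _)); intros a; apply All; intros b.
    exists (nu (a + b)); now rewrite HP.
  - apply (All (fun x => forall y, num y -> _)); intros a; apply All; intros b.
    exists (nu (a * b)); now rewrite HT.
  - intros x [a ->]%Num y [b ->]%Num z [c ->]%Num z' [c' ->]%Num; rewrite !HP.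
    intros [-> ->]; easy.
  - intros x [a ->]%Num y [b ->]%Num z [c ->]%Num z' [c' ->]%Num; rewrite !HT.
    intros [-> ->]; easy.
  - intros x [a ->]%Num; rewrite HP; lia.
  - intros x [a ->]%Num y [b ->]%Num z [c ->]%Num z' [c' ->]%Num w [d ->]%Num; rewrite !HP; lia.
  - intros x [a ->]%Num; rewrite HT; lia.
  - intros x [a ->]%Num y [b ->]%Num z [c ->]%Num z' [c' ->]%Num w [d ->]%Num.
    rewrite !HP, !HT; lia.
  - intros x [a ->]%Num; rewrite HP; lia.
  - intros x [a ->]%Num y [b ->]%Num z [c ->]%Num; rewrite !HP; intros; f_equal; lia.
  - intros u [H0 HS]; apply All; intros n; induction n as [|n IH]; auto.
    apply (HS (nu n) (Nn n)); auto; split; auto; rewrite HP; lia.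
Qed.

(** [nu] iterates the successor from [o]. The last clause makes it onto the numbers once there is an
    element [u] above exactly the standard ones; a mere order need not have one, but the lattice of
    open sets does. *)
Lemma arithmetic_nu {L} (le : L -> L -> Prop) num PL TI o one :
  arithmetic le num PL TI o one ->
  exists nu : nat -> L,
    (forall n, num (nu n)) /\
    (forall m n, nu m = nu n -> m = n) /\
    (forall a b c, PL (nu a) (nu b) (nu c) <-> a + b = c) /\
    (forall a b c, TI (nu a) (nu b) (nu c) <-> a * b = c) /\
    (forall u, (forall x, num x -> le x u -> exists n, x = nu n) ->
       (forall n, le (nu n) u) -> forall x, num x -> exists n, x = nu n).
Proof.
  intros ((No & N1) & TP & TT & UP & UT & P0 & PS & T0 & TS & S0 & SI & Ind).
  (* The successor is chosen on all of [L], with arbitrary values outside the numbers. *)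
  destruct (functional_choice (fun x z => num x -> num z /\ PL x one z)) as [s Hs].
  { intros x; destruct (classic (num x)) as [H|H]; [|exists x; easy].
    destruct (TP x H one N1) as (z & Hz); eauto. }
  set (nu n := Nat.iter n s o).
  assert (forall n, num (nu n)) as Nn by (induction n; [easy|apply Hs, IHn]).
  assert (forall n, PL (nu n) one (nu (S n))) as HS by (intros; apply Hs, Nn).
  assert (forall a b, PL (nu a) (nu b) (nu (a + b))) as HP.
  { intros a; induction b as [|b IH]; [rewrite Nat.add_0_r; auto|].
    rewrite Nat.add_succ_r.
    apply (PS _ (Nn a) _ (Nn b) _ (Nn (S b)) _ (Nn (a + b)) _ (Nn _)); auto. }
  assert (forall a b, TI (nu a) (nu b) (nu (a * b))) as HT.
  { intros a; induction b as [|b IH]; [rewrite Nat.mul_0_r; auto|].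
    rewrite Nat.mul_succ_r.
    apply (TS _ (Nn a) _ (Nn b) _ (Nn (S b)) _ (Nn (a * b)) _ (Nn _)); auto. }
  assert (forall m n, nu m = nu n -> m = n) as Inj.
  { induction m as [|m IH]; intros [|n] E; auto.
    - destruct (S0 _ (Nn n)); change o with (nu 0); rewrite E; auto.
    - destruct (S0 _ (Nn m)); change o with (nu 0); rewrite <- E; auto.
    - f_equal; apply IH, (SI _ (Nn m) _ (Nn n) _ (Nn (S n))); split; auto; rewrite <- E; auto. }
  exists nu; repeat split; auto.
  - intros H; apply Inj, (UP _ (Nn a) _ (Nn b) _ (Nn _) _ (Nn _)); auto.
  - intros <-; auto.
  - intros H; apply Inj, (UT _ (Nn a) _ (Nn b) _ (Nn _) _ (Nn _)); auto.
  - intros <-; auto.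
  - intros u Hu Hn x Hx; apply Hu; [easy|]; revert x Hx; apply Ind; split; [apply (Hn 0)|].
    intros x Hx y Hy [Hxu Hxy]; destruct (Hu x Hx Hxu) as [n ->].
    replace y with (nu (S n)); [auto|].
    apply (UP _ (Nn n) _ N1 _ (Nn (S n)) _ Hy); auto.
Qed.

(* The parameters are: [0] the numbers, [1], [2], [3] their components, [4]
   addition, [5] multiplication, [6] zero, [7] one, [8] the marker. *)
Definition Le (x y : nat) : form := FRel 0 [x; y].

(** The formulas from here to [coded_form] reserve separate bound variables, 30 to 36 in total,
    above all parameters and arguments from outside, so nesting them causes no capture. *)
Definition prime_form (d : nat) : form :=
  FEx 30 (FAnd (FAnd (Le 30 d) (FNot (Le d 30)))
    (FAll 31 (FImp (FAnd (Le 31 d) (FNot (Le d 31))) (Le 31 30)))).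

Definition max_prime_form (n d : nat) : form :=
  FAnd (prime_form d) (FAnd (Le d n)
    (FAll 32 (FImp (FAnd (prime_form 32) (FAnd (Le 32 n) (Le d 32))) (Le 32 d)))).

Definition coded_form (p x y z : nat) : form :=
  FEx 33 (FAnd (FAnd (max_prime_form 1 33) (Le x 33))
  (FEx 34 (FAnd (FAnd (max_prime_form 2 34) (Le y 34))
  (FEx 35 (FAnd (FAnd (max_prime_form 3 35) (Le z 35))
    (FAll 36 (FImp (FAnd (Le 36 33) (FAnd (Le 36 34) (Le 36 35))) (Le 36 p)))))))).

Definition num_form (x : nat) : form := max_prime_form 0 x.
Definition all_num (x : nat) (p : form) : form := FAll x (FImp (num_form x) p).
Definition ex_num (x : nat) (p : form) : form := FEx x (FAnd (num_form x) p).

Definition arithmetic_form : form :=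
  FAnd (FAnd (num_form 6) (num_form 7))
  (FAnd (all_num 12 (all_num 13 (ex_num 14 (coded_form 4 12 13 14))))
  (FAnd (all_num 12 (all_num 13 (ex_num 14 (coded_form 5 12 13 14))))
  (FAnd (all_num 12 (all_num 13 (all_num 14 (all_num 15
     (FImp (FAnd (coded_form 4 12 13 14) (coded_form 4 12 13 15)) (FEq 14 15))))))
  (FAnd (all_num 12 (all_num 13 (all_num 14 (all_num 15
     (FImp (FAnd (coded_form 5 12 13 14) (coded_form 5 12 13 15)) (FEq 14 15))))))
  (FAnd (all_num 12 (coded_form 4 12 6 12))
  (FAnd (all_num 12 (all_num 13 (all_num 14 (all_num 15 (all_num 16
     (FImp (FAnd (coded_form 4 13 7 14) (FAnd (coded_form 4 12 13 15) (coded_form 4 15 7 16)))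
           (coded_form 4 12 14 16)))))))
  (FAnd (all_num 12 (coded_form 5 12 6 6))
  (FAnd (all_num 12 (all_num 13 (all_num 14 (all_num 15 (all_num 16
     (FImp (FAnd (coded_form 4 13 7 14) (FAnd (coded_form 5 12 13 15) (coded_form 4 15 12 16)))
           (coded_form 5 12 14 16)))))))
  (FAnd (all_num 12 (FNot (coded_form 4 12 7 6)))
  (FAnd (all_num 12 (all_num 13 (all_num 14
     (FImp (FAnd (coded_form 4 12 7 14) (coded_form 4 13 7 14)) (FEq 12 13)))))
  (FAll 17 (FImp (FAnd (Le 6 17) (all_num 12 (all_num 13
              (FImp (FAnd (Le 12 17) (coded_form 4 12 7 13)) (Le 13 17)))))
     (all_num 12 (Le 12 17)))))))))))))).

(* The element [8] is joined to representatives of sets to keep them apart from numbers. *)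
Definition marker_form : form := all_num 12 (FAnd (FNot (Le 12 8)) (FNot (Le 8 12))).

(** Every element that is not a number stands for the set of numbers below it. Equality is therefore
    identity on numbers and a coarser equivalence on the representatives of sets. *)
Definition N2_in_lattice : interpretation := {|
  npar := 9; shift := 12;
  eqf := FOr (FAnd (num_form 9) (FEq 9 10))
    (FAnd (FNot (num_form 9)) (FAnd (FNot (num_form 10))
      (all_num 12 (FAnd (FImp (Le 12 9) (Le 12 10)) (FImp (Le 12 10) (Le 12 9))))));
  rels := [(1, num_form 9);
           (1, FNot (num_form 9));
           (2, FAnd (num_form 9) (FAnd (FNot (num_form 10)) (Le 9 10)));
           (3, FAnd (FAnd (num_form 9) (FAnd (num_form 10) (num_form 11))) (coded_form 4 9 10 11));
           (3, FAnd (FAnd (num_form 9) (FAnd (num_form 10) (num_form 11))) (coded_form 5 9 10 11))];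
  good := FAnd arithmetic_form marker_form
|}.

(** A computable counterpart of [free_in], by which the variable bounds of the large formulas are
    checked by evaluation. *)
Fixpoint free_vars (p : form) : list nat :=
  match p with
  | FEq y z => [y; z]
  | FRel _ args => args
  | FFalse => []
  | FNot a => free_vars a
  | FAnd a b | FOr a b | FImp a b => free_vars a ++ free_vars b
  | FAll y a | FEx y a => remove Nat.eq_dec y (free_vars a)
  end.

Lemma free_in_free_vars x p : free_in x p -> In x (free_vars p).
Proof.
  induction p; cbn; rewrite ?in_app_iff; auto; try tauto.
  - intuition.
  - intros [N H]; apply in_in_remove; auto.
  - intros [N H]; apply in_in_remove; auto.
Qed.

Lemma wf_N2_in_lattice : wf_interpretation sig_lattice N2_in_lattice.
Proof.
  assert (forall n p, forallb (fun x => x <? n) (free_vars p) = true ->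
    forall x, free_in x p -> x < n) as F.
  { intros n p H x Fx; rewrite forallb_forall in H.
    apply Nat.ltb_lt, H, free_in_free_vars, Fx. }
  split.
  - cbn; tauto.
  - intros n t H; repeat (destruct H as [[= <- <-]|H]; [cbn; tauto|]); easy.
  - cbn; tauto.
  - intros x; apply F; reflexivity.
  - intros n t x H; repeat (destruct H as [[= <- <-]|H]; [apply F; reflexivity|]); easy.
  - intros x; apply F; reflexivity.
  - cbn; lia.
  - intros n t H; repeat (destruct H as [[= <- <-]|H]; [cbn; lia|]); easy.
Qed.

(** * Semantics of the formulas in the lattice, and correctness of the interpretation *)

Definition le_open {X} (U V : Sigma01 X) : Prop := forall x, proj1_sig U x -> proj1_sig V x.

Lemma le_open_antisym {X} (U V : Sigma01 X) : le_open U V -> le_open V U -> U = V.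
Proof. intros H1 H2; apply open_ext; split; auto. Qed.

Lemma all_iff {A} (P Q : A -> Prop) :
  (forall x, P x <-> Q x) -> (forall x, P x) <-> (forall x, Q x).
Proof. firstorder. Qed.

Lemma ex_iff {A} (P Q : A -> Prop) :
  (forall x, P x <-> Q x) -> (exists x, P x) <-> (exists x, Q x).
Proof. firstorder. Qed.

Lemma and_iff (P Q P' Q' : Prop) : (P <-> P') -> (Q <-> Q') -> P /\ Q <-> P' /\ Q'.
Proof. tauto. Qed.

Lemma imp_iff (P Q P' Q' : Prop) : (P <-> P') -> (Q <-> Q') -> (P -> Q) <-> (P' -> Q').
Proof. tauto. Qed.

Ltac upd_simpl := repeat match goal with
  | |- context [upd ?r ?x ?d ?x] => rewrite (upd_eq r x d)
  | |- context [upd ?r ?x ?d ?y] => rewrite (upd_neq r x y d) by lia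
  end.

(** Descends in parallel through the satisfaction of a formula and a property of the same shape,
    leaving the atomic parts to [leaf]. *)
Ltac iff_struct leaf := repeat lazymatch goal with
  | |- _ /\ _ <-> _ => apply and_iff
  | |- ~ _ <-> _ => apply not_iff_compat
  | |- (exists _, _) <-> _ => apply ex_iff; intro
  | |- (forall _ : ?A, _) <-> _ =>
      lazymatch type of A with Prop => apply imp_iff | _ => apply all_iff; intro end
  | |- _ => leaf
  end.

Section Semantics.
Context {X : subbased_space}.
Notation M := (Sigma01_str X).
Notation prime := (prime (@le_open X)).
Notation max_prime := (max_prime (@le_open X)).
Notation coded := (coded (@le_open X)).

Lemma sat_prime (rho : nat -> dom M) d : d < 30 \/ 31 < d ->
  sat M rho (prime_form d) <-> prime (rho d).
Proof.
  intros L; unfold prime_form, prime; cbn [sat Le].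
  iff_struct ltac:(cbn [interp Sigma01_str map]; upd_simpl; reflexivity).
Qed.

Lemma sat_max_prime (rho : nat -> dom M) n d : n < 30 -> d < 30 \/ 32 < d ->
  sat M rho (max_prime_form n d) <-> max_prime (rho n) (rho d).
Proof.
  intros Ln Ld; unfold max_prime_form, max_prime; cbn [sat Le].
  iff_struct ltac:(first [rewrite sat_prime by lia; upd_simpl; reflexivity
    |cbn [interp Sigma01_str map]; upd_simpl; reflexivity]).
Qed.

Lemma sat_coded (rho : nat -> dom M) p x y z : p < 30 -> x < 30 -> y < 30 -> z < 30 ->
  sat M rho (coded_form p x y z) <->
  coded (rho 1) (rho 2) (rho 3) (rho p) (rho x) (rho y) (rho z).
Proof.
  intros Lp Lx Ly Lz; unfold coded_form, coded; cbn [sat Le].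
  iff_struct ltac:(first [rewrite sat_max_prime by lia; upd_simpl; reflexivity
    |cbn [interp Sigma01_str map]; upd_simpl; reflexivity]).
Qed.

Definition num (rho : nat -> dom M) : Sigma01 X -> Prop := max_prime (rho 0).
Definition tern (rho : nat -> dom M) (p : nat) : Sigma01 X -> Sigma01 X -> Sigma01 X -> Prop :=
  coded (rho 1) (rho 2) (rho 3) (rho p).

Lemma sat_arithmetic (rho : nat -> dom M) :
  sat M rho arithmetic_form <->
  arithmetic le_open (num rho) (tern rho 4) (tern rho 5) (rho 6) (rho 7).
Proof.
  unfold arithmetic_form, arithmetic; cbn [sat all_num ex_num num_form Le].
  iff_struct ltac:(idtac; lazymatch goal with
    | |- sat _ _ (num_form _) <-> _ => unfold num_form; rewrite sat_max_prime by lia; reflexivity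
    | |- sat _ _ (coded_form _ _ _ _) <-> _ => rewrite sat_coded by lia; reflexivity
    | |- interp _ _ _ <-> _ => reflexivity
    | |- _ = _ <-> _ => reflexivity
    end).
Qed.

Lemma sat_marker (rho : nat -> dom M) :
  sat M rho marker_form <->
  forall x, num rho x -> ~ le_open x (rho 8) /\ ~ le_open (rho 8) x.
Proof.
  unfold marker_form; cbn [sat all_num num_form Le].
  iff_struct ltac:(idtac; lazymatch goal with
    | |- sat _ _ (num_form _) <-> _ => unfold num_form; rewrite sat_max_prime by lia; reflexivity
    | |- interp _ _ _ <-> _ => reflexivity
    end).
Qed.

Definition union {J} (P : J -> Prop) (U : J -> Sigma01 X) : Sigma01 X :=
  exist _ (fun x => exists j, P j /\ proj1_sig (U j) x)
    (open_union X P (fun j => proj1_sig (U j)) (fun j _ => proj2_sig (U j))).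

(** Let [c] be greatest strictly below [d]. A point of [d] outside [c] lies in some [U j]; then the
    intersection of [d] and [U j] is not below [c], so it is not strictly below [d] and must be all
    of [d]. *)
Lemma prime_union {J} (P : J -> Prop) (U : J -> Sigma01 X) (d : Sigma01 X) :
  prime d -> le_open d (union P U) -> exists j, P j /\ le_open d (U j).
Proof.
  intros (c & [Hcd Hdc] & Hc) Hd.
  apply not_all_ex_not in Hdc as [x Hx]; apply imply_to_and in Hx as [Hx Nx].
  destruct (Hd x Hx) as (j & Pj & Hj); exists j; split; [easy|].
  set (e := exist _ (fun y => proj1_sig d y /\ proj1_sig (U j) y)
        (open_inter X _ _ (proj2_sig d) (proj2_sig (U j))) : Sigma01 X).
  apply NNPP; intros N; apply Nx, (Hc e); [|easy]; split.
  - intros y []; easy.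
  - intros H; apply N; intros y Hy; now apply H in Hy as [].
Qed.

Lemma union_le {J} (P : J -> Prop) (U : J -> Sigma01 X) j : P j -> le_open (U j) (union P U).
Proof. intros Hj x Hx; now exists j. Qed.

Lemma max_prime_eq n d e : max_prime n d -> max_prime n e -> le_open d e -> d = e.
Proof.
  intros (Pd & Dn & Md) (Pe & En & Me) H; apply le_open_antisym; auto.
Qed.

(** [h] inverts [nu] on numbers and sends any other [U] to the set of [n] with [nu n] below [U]. A
    set [A] is attained at the union of its numbers and the marker. *)
Lemma N2_in_lattice_sound (rho : nat -> dom M) :
  arithmetic le_open (num rho) (tern rho 4) (tern rho 5) (rho 6) (rho 7) ->
  (forall x, num rho x -> ~ le_open x (rho 8) /\ ~ le_open (rho 8) x) ->
  exists h : Sigma01 X -> N2_dom,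
    (forall m, exists d, h d = m) /\
    (forall U, num rho U <-> exists n, h U = inl n) /\
    (forall U V n A, h U = inl n -> h V = inr A -> le_open U V <-> A n) /\
    (forall U V m n, h U = inl m -> h V = inl n -> U = V <-> m = n) /\
    (forall U V W a b c, h U = inl a -> h V = inl b -> h W = inl c ->
       (tern rho 4 U V W <-> a + b = c) /\ (tern rho 5 U V W <-> a * b = c)).
Proof.
  intros Ar Mk; destruct (arithmetic_nu _ _ _ _ _ _ Ar) as (nu & Nn & Inj & HP & HT & Ind).
  (* Joining an element [W] above no number, indexed by [None], adds no numbers below the union. *)
  assert (forall d, num rho d -> forall A W, (forall m, num rho m -> ~ le_open m W) ->
    le_open d (union (fun j => match j with Some n => A n | None => True end)
                  (fun j => match j with Some n => nu n | None => W end)) ->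
    exists n, A n /\ d = nu n) as Pr.
  { intros d Hd A W HW Hle.
    destruct (prime_union _ _ _ (proj1 Hd) Hle) as ([n|] & Pn & Hn).
    - exists n; split; [easy|].
      apply (max_prime_eq (rho 0)); [exact Hd|apply Nn|exact Hn].
    - now apply HW in Hn. }
  (* The union of the standard numbers serves as [u] in the induction: a number below it is prime,
     so it lies below a standard number and equals it by maximality. *)
  assert (forall x, num rho x -> exists n, x = nu n) as Sur.
  { apply (Ind (union (fun _ : nat => True) nu)).
    - intros x Hx Hle.
      destruct (prime_union _ _ _ (proj1 Hx) Hle) as (n & _ & Hn).
      exists n; apply (max_prime_eq (rho 0)); [exact Hx|apply Nn|exact Hn].
    - intros n; now apply union_le. }
  destruct (functional_choice (fun U (d : N2_dom) => (exists n, U = nu n /\ d = inl n) \/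
      (~ num rho U /\ d = inr (fun n => le_open (nu n) U)))) as [h Hh].
  { intros U; destruct (classic (num rho U)) as [H|H].
    - destruct (Sur U H) as [n ->]; exists (inl n); eauto.
    - exists (inr (fun n => le_open (nu n) U)); auto. }
  assert (forall n, h (nu n) = inl n) as Hnu.
  { intros n; destruct (Hh (nu n)) as [(m & E%Inj & ->)|[H _]]; [now subst|now destruct H]. }
  assert (forall U n, h U = inl n -> U = nu n) as Hinl.
  { intros U n E; destruct (Hh U) as [(m & -> & E')|[_ E']]; congruence. }
  exists h; split; [|split; [|split; [|split]]].
  - intros [n|A]; [now exists (nu n)|].
    set (U := union (fun j => match j with Some n => A n | None => True end)
                    (fun j => match j with Some n => nu n | None => rho 8 end)).
    exists U; assert (le_open (rho 8) U) as H8 by (intros x Hx; now exists None).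
    (* Both halves of the marker condition are used: the marker is below no number, so [U] is not a
       number; and no number is below the marker, so [U] represents exactly [A]. *)
    destruct (Hh U) as [(n & E & _)|[_ ->]].
    + rewrite E in H8; now apply Mk in H8.
    + f_equal; extensionality n; apply propositional_extensionality; split.
      * intros H; apply Pr in H as (m & Hm & ->%Inj); auto; intros; now apply Mk.
      * intros H x Hx; now exists (Some n).
  - intros U; split; [intros H; destruct (Sur U H) as [n ->]; eauto|].
    intros [n ->%Hinl]; auto.
  - intros U V n A ->%Hinl E; destruct (Hh V) as [(m & -> & E')|[_ E']]; [congruence|].
    rewrite E in E'; injection E' as ->; tauto.
  - intros U V m n ->%Hinl ->%Hinl; split; [apply Inj|congruence].
  - intros U V W a b c ->%Hinl ->%Hinl ->%Hinl; auto.
Qed.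

Lemma N2_in_lattice_correct :
  (exists rho, sat M rho (good N2_in_lattice)) ->
  interpretation_of N2_in_lattice N2 M.
Proof.
  intros Ex; split; [easy|]; cbn [npar N2_in_lattice eqf rels good].
  intros rho [Ar Mk]; apply sat_arithmetic in Ar; pose proof (proj1 (sat_marker rho) Mk) as Mk'.
  destruct (N2_in_lattice_sound rho Ar Mk') as (h & Sur & Num & Mem & Eq & Op).
  exists h; split; [easy|]; intros rho' Ag.
  assert (forall x, x < 30 -> sat M rho' (num_form x) <-> exists n, h (rho' x) = inl n) as SN.
  { intros x L; unfold num_form; rewrite sat_max_prime, (Ag 0) by lia; apply Num. }
  assert (forall p x y z, p < 9 -> x < 30 -> y < 30 -> z < 30 ->
    sat M rho' (coded_form p x y z) <-> tern rho p (rho' x) (rho' y) (rho' z)) as ST.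
  { intros p x y z Lp Lx Ly Lz; rewrite sat_coded by lia.
    rewrite (Ag 1), (Ag 2), (Ag 3), (Ag p) by lia; reflexivity. }
  split.
  - cbn [sat all_num]; rewrite !SN by lia; split.
    + intros [[[n E] ->]|[N1 [N2 H]]]; [easy|].
      destruct (h (rho' 9)) as [n|A] eqn:E1; [destruct N1; eauto|].
      destruct (h (rho' 10)) as [n|B] eqn:E2; [destruct N2; eauto|].
      f_equal; extensionality n; apply propositional_extensionality.
      destruct (Sur (inl n)) as [U EU]; destruct (H U) as [K1 K2].
      { unfold num_form; rewrite sat_max_prime by lia; rewrite upd_eq, upd_neq, (Ag 0) by lia.
        apply Num; eauto. }
      rewrite <- (Mem _ _ _ _ EU E1), <- (Mem _ _ _ _ EU E2); split; [apply K1|apply K2].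
    + intros E; destruct (h (rho' 9)) as [n|A] eqn:E1.
      * left; split; [eauto|]; now apply (Eq _ _ n n).
      * symmetry in E; right; split; [intros [n ?]; easy|]; split; [intros [n ?]; congruence|].
        intros U HU; unfold num_form in HU; rewrite sat_max_prime in HU by lia.
        rewrite upd_eq, upd_neq, (Ag 0) in HU by lia; apply Num in HU as [n En].
        pose proof (Mem _ _ _ _ En E1) as K1; pose proof (Mem _ _ _ _ En E) as K2.
        split; intros K; [apply K2, K1, K|apply K1, K2, K].
  - intros r n t E; destruct r as [|[|[|[|[|r]]]]];
      try (cbn in E; injection E as <- <-); [..|now destruct r];
      cbn [sat seq map interp N2]; rewrite ?SN by lia.
    + destruct (h (rho' 9)); cbn; split; eauto; try easy; now intros [].
    + destruct (h (rho' 9)); cbn; split; try easy; [intros H'; destruct H'; eauto|now intros _ []].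
    + change (interp M 0 (map rho' [9; 10])) with (le_open (rho' 9) (rho' 10)).
      destruct (h (rho' 9)) as [m|] eqn:E1, (h (rho' 10)) as [n|B] eqn:E2; cbn;
        try (split; [intros ([? ?] & N2 & _); try easy; destruct N2; eauto|easy]).
      rewrite (Mem _ _ _ _ E1 E2); split; [easy|]; intros HB.
      split; [eauto|split; [now intros []|easy]].
    + rewrite ST by lia.
      destruct (h (rho' 9)) as [a|] eqn:E1, (h (rho' 10)) as [b|] eqn:E2,
        (h (rho' 11)) as [c|] eqn:E3;
        cbn; try (split; [now intros [([? ?] & [? ?] & [? ?]) _]|easy]).
      rewrite (proj1 (Op _ _ _ _ _ _ E1 E2 E3)); split; [easy|]; intros; repeat split; eauto.
    + rewrite ST by lia.
      destruct (h (rho' 9)) as [a|] eqn:E1, (h (rho' 10)) as [b|] eqn:E2,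
        (h (rho' 11)) as [c|] eqn:E3;
        cbn; try (split; [now intros [([? ?] & [? ?] & [? ?]) _]|easy]).
      rewrite (proj2 (Op _ _ _ _ _ _ E1 E2 E3)); split; [easy|]; intros; repeat split; eauto.
Qed.

End Semantics.

(** * Existence of the arithmetical parameters *)

Section Standard.
Context {X : subbased_space} (PX : presentation X) (alpha : nat -> nat).
Context (alpha_inj : forall i j, alpha i = alpha j -> i = j)
  (alpha_valid : forall i, valid PX (alpha i))
  (alpha_ok : forall i j, ok PX (alpha i) (alpha j)).
Notation prime := (prime (@le_open X)).
Notation max_prime := (max_prime (@le_open X)).
Notation coded := (coded (@le_open X)).

Definition cyl (F : list nat) : Sigma01 X :=
  exist _ (fun x => forall i, In i F -> mem PX x (alpha i))
    (open_inter_list X (fun i x => mem PX x (alpha i)) F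
      (fun i _ => mem_open _ PX (alpha i))).

(** [p] is the point whose atoms are exactly those indexed by [F]. If an open [U] contains [p],
    finitely many atoms of [p] already force membership in [U], and all of [cyl F] satisfies
    them. *)
Lemma cyl_point F : exists p, proj1_sig (cyl F) p /\
  (forall G, proj1_sig (cyl G) p -> incl G F) /\
  (forall U : Sigma01 X, proj1_sig U p -> le_open (cyl F) U).
Proof.
  destruct (point _ PX (map alpha F)) as [p Hp].
  - intros a (i & <- & _)%in_map_iff; auto.
  - intros a b (i & <- & _)%in_map_iff (j & <- & _)%in_map_iff; auto.
  - exists p; split; [|split].
    + intros i Hi; now apply Hp, in_map.
    + intros G HG i Hi; apply HG, Hp, in_map_iff in Hi as (j & ->%alpha_inj & Hj); easy.
    + intros U HU x Hx; destruct (base _ PX _ _ (proj2_sig U) HU) as (F' & HF & H).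
      apply H; intros a Ha; apply HF, Hp, in_map_iff in Ha as (i & <- & Hi); auto.
Qed.

Lemma cyl_le F G : le_open (cyl F) (cyl G) <-> incl G F.
Proof.
  split.
  - intros H; destruct (cyl_point F) as (p & Hp & HG & _); apply HG, H, Hp.
  - intros H x Hx i Hi; apply Hx, H, Hi.
Qed.

(** The union of all opens strictly below [cyl F] is still strictly below it, as none of them
    contains the least point. *)
Lemma cyl_prime F : prime (cyl F).
Proof.
  destruct (cyl_point F) as (p & Hp & _ & HU).
  exists (union (fun V : Sigma01 X => le_open V (cyl F) /\ ~ le_open (cyl F) V) (fun V => V)).
  split; [split|].
  - intros x (V & [H _] & Hx); auto.
  - intros H; destruct (H p Hp) as (V & [_ N] & HV); now apply N, HU.
  - intros V HV; now apply (union_le _ (fun V : Sigma01 X => V)).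
Qed.

Lemma max_prime_cyls {J} (f : J -> list nat) d :
  (forall j j', incl (f j) (f j') -> f j = f j') ->
  max_prime (union (fun _ => True) (fun j => cyl (f j))) d <-> exists j, d = cyl (f j).
Proof.
  intros Anti; split.
  - intros (Pd & Hd & Md); destruct (prime_union _ _ _ Pd Hd) as (j & _ & Hj).
    exists j; apply le_open_antisym; [easy|]; apply Md; split; [apply cyl_prime|split; [|easy]].
    now apply (union_le (fun _ => True) (fun j => cyl (f j))).
  - intros (j & ->); split; [apply cyl_prime|split].
    + now apply (union_le (fun _ => True) (fun j => cyl (f j))).
    + intros e (Pe & He & Hj); destruct (prime_union _ _ _ Pe He) as (j' & _ & Hj').
      enough (f j = f j') as -> by easy; symmetry; apply Anti, cyl_le.
      intros x Hx; auto.
Qed.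

(* The atoms congruent to 3 modulo 4 are left to the marker. *)
Definition number (n : nat) : list nat := [4 * n; 4 * n + 1; 4 * n + 2].
Definition component (i n : nat) : list nat := [4 * n + i].

(** The residues modulo 4 record the argument places, so a triple can be read off its three atoms
    even when arguments coincide. The three chosen components meet in a cylinder, which is prime and
    hence lies below a single member of the code of [op]. *)
Lemma coded_cyls (op : nat -> nat -> nat) a b c :
  coded (union (fun _ => True) (fun n => cyl (component 0 n)))
        (union (fun _ => True) (fun n => cyl (component 1 n)))
        (union (fun _ => True) (fun n => cyl (component 2 n)))
        (union (fun _ => True)
           (fun v => cyl [4 * fst v; 4 * snd v + 1; 4 * op (fst v) (snd v) + 2]))
        (cyl (number a)) (cyl (number b)) (cyl (number c)) <-> c = op a b.
Proof.
  (* [number n] has a single index of residue [i], so only one component of kind [i] contains its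
     cylinder. *)
  assert (forall i d n, i < 3 ->
     max_prime (union (fun _ => True) (fun n => cyl (component i n))) d /\
     le_open (cyl (number n)) d <-> d = cyl (component i n)) as Comp.
  { intros i d n Li; rewrite max_prime_cyls.
    - split; [|intros ->; split; [eauto|]].
      + intros [(m & ->) H]; rewrite cyl_le in H.
        assert (In (4 * m + i) (number n)) as Hi by (apply H; now left).
        enough (m = n) as -> by easy; cbn in Hi; lia.
      + apply cyl_le; intros j [<-|[]]; unfold number.
        destruct i as [|[|[|]]]; [left; lia|right; left; lia|right; right; left; lia|lia].
    - intros m m' H; assert (In (4 * m + i) (component i m')) as Hi by (apply H; now left).
      enough (m = m') as -> by easy; cbn in Hi; lia. }
  split.
  - intros (x & Hx & y & Hy & z & Hz & H).
    apply Comp in Hx as ->, Hy as ->, Hz as ->; try lia.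
    (* This cylinder is taken as the [u] of [coded]. *)
    assert (le_open (cyl [4 * a; 4 * b + 1; 4 * c + 2]) (union (fun _ => True)
           (fun v => cyl [4 * fst v; 4 * snd v + 1; 4 * op (fst v) (snd v) + 2]))) as Hle.
    { apply H; rewrite !cyl_le; unfold component.
      split; [|split]; intros j [<-|[]]; cbn [In]; lia. }
    apply prime_union in Hle as ([m n] & _ & Hle); [|apply cyl_prime].
    apply cyl_le in Hle; cbn [fst snd] in Hle.
    assert (In (4 * m) [4 * a; 4 * b + 1; 4 * c + 2]) as H0 by (apply Hle; cbn; auto).
    assert (In (4 * n + 1) [4 * a; 4 * b + 1; 4 * c + 2]) as H1 by (apply Hle; cbn; auto).
    assert (In (4 * op m n + 2) [4 * a; 4 * b + 1; 4 * c + 2]) as H2 by (apply Hle; cbn; auto).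
    cbn [In] in H0, H1, H2; assert (m = a) as -> by lia; assert (n = b) as -> by lia; lia.
  - intros ->.
    exists (cyl (component 0 a)); split; [now apply Comp; [lia|]|].
    exists (cyl (component 1 b)); split; [now apply Comp; [lia|]|].
    exists (cyl (component 2 (op a b))); split; [now apply Comp; [lia|]|].
    intros u (H0 & H1 & H2) x Hx; exists (a, b); split; [easy|].
    intros i [<-|[<-|[<-|[]]]]; cbn [fst snd].
    + apply (H0 x Hx); left; lia.
    + apply (H1 x Hx); now left.
    + apply (H2 x Hx); now left.
Qed.

Lemma N2_in_lattice_satisfiable :
  exists rho, sat (Sigma01_str X) rho (good N2_in_lattice).
Proof.
  set (code := fun op : nat -> nat -> nat => union (fun _ => True)
           (fun v => cyl [4 * fst v; 4 * snd v + 1; 4 * op (fst v) (snd v) + 2])).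
  set (comp := fun i => union (fun _ => True) (fun n => cyl (component i n))).
  set (nums := union (fun _ => True) (fun n => cyl (number n))).
  (* The list fills the positions 0 to 7; the default value [cyl [3]] is the marker at position
     8. *)
  exists (fun i => nth i [nums; comp 0; comp 1; comp 2; code Nat.add; code Nat.mul;
                          cyl (number 0); cyl (number 1)] (cyl [3])).
  assert (forall m n, incl (number m) (number n) -> m = n) as Inj.
  { intros m n H; assert (In (4 * m) (number n)) as Hm by (apply H; now left).
    cbn in Hm; lia. }
  assert (forall d, max_prime nums d <-> exists n, d = cyl (number n)) as Num.
  { intros d; apply max_prime_cyls; intros m n E%Inj; now subst. }
  cbn [good N2_in_lattice sat]; split.
  - apply sat_arithmetic.
    apply (arithmetic_std _ _ _ _ (fun n => cyl (number n))).
    + intros m n E; apply Inj, cyl_le; rewrite E; now intros x.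
    + exact Num.
    + apply coded_cyls.
    + apply coded_cyls.
  - apply sat_marker; intros x Hx; apply Num in Hx as [n ->]; cbn [nth]; rewrite !cyl_le; split.
    + intros H; assert (In 3 (number n)) as H3 by (apply H; now left); cbn in H3; lia.
    + intros H; assert (In (4 * n) [3]) as H3 by (apply H; now left); cbn in H3; lia.
Qed.

Lemma mequiv_N2 vf okf :
  defines_unary vf (valid PX) -> defines_binary okf (ok PX) ->
  mequiv (codes (FO sig_lattice (Sigma01_str X))) (codes (FO sig_N2 N2)).
Proof.
  intros Dv Do; split.
  - apply (trans_mreducible _ _ (lattice_in_N2 vf okf)); [|easy|].
    + now apply (wf_lattice_in_N2 PX).
    + now apply (lattice_in_N2_correct PX).
  - apply (trans_mreducible _ _ N2_in_lattice); [apply wf_N2_in_lattice|easy|].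
    apply N2_in_lattice_correct, N2_in_lattice_satisfiable.
Qed.

End Standard.

(** * The spaces *)

Lemma base_of_subbase (X : subbased_space) (mem : pt X -> nat -> Prop) :
  (forall B, subbase X B -> exists F, forall y, B y <-> forall a, In a F -> mem y a) ->
  forall V x, is_open X V -> V x ->
  exists F, (forall a, In a F -> mem x a) /\ forall y, (forall a, In a F -> mem y a) -> V y.
Proof.
  intros HB V x HV Hx; destruct (HV x Hx) as (Bs & H1 & H2 & H3).
  assert (exists F, (forall a, In a F -> mem x a) /\
    forall y, (forall a, In a F -> mem y a) -> forall B, In B Bs -> B y) as (F & F1 & F2).
  { clear H3; induction Bs as [|B Bs IH].
    - exists []; split; [easy|intros y _ B []].
    - destruct IH as (F & F1 & F2); [intros; apply H1; now right|intros; apply H2; now right|].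
      destruct (HB B) as [G HG]; [apply H1; now left|].
      exists (G ++ F); split.
      + intros a [Ha|Ha]%in_app_iff; auto; apply HG; auto; apply H2; now left.
      + intros y Hy C [<-|HC].
        * apply HG; intros a Ha; apply Hy, in_app_iff; auto.
        * apply F2; auto; intros a Ha; apply Hy, in_app_iff; auto. }
  exists F; split; [exact F1|]; intros y Hy; exact (H3 y (F2 y Hy)).
Qed.

Lemma Pomega_presentation : exists PX : presentation Pomega,
  (forall a, valid PX a) /\ (forall a b, ok PX a b).
Proof.
  unshelve eexists (Build_presentation Pomega (fun A n => A n) (fun _ => True) (fun _ _ => True)
    _ _ _ _ _ _ _); try easy.
  - intros a A HA; exists [fun B : nat -> Prop => B a]; repeat split.
    + intros B [<-|[]]; exists [a]; intros B; split; [now intros ? ? [<-|[]]|].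
      intros H; apply H; now left.
    + now intros B [<-|[]].
    + intros B H; now apply (H (fun B => B a)); left.
  - intros F _ _; exists (fun a => In a F); intros a; reflexivity.
  - apply base_of_subbase; intros B [F HF]; exists F; apply HF.
Qed.

Section Kbot.
Context (k : option nat).

(** The atom for [g i = v] is [pr i v], since [pr_form] defines this pairing and with it validity
    and consistency. Numbers outside the range of [pr] are invalid. *)
Definition graph_mem (g : pfun k) (a : nat) : Prop :=
  exists i v, a = pr i v /\ proj1_sig g i = Some v.
Definition kvalid (a : nat) : Prop := exists i v, a = pr i v /\ in_range k v.
Definition kok (a b : nat) : Prop := forall i v w, a = pr i v -> b = pr i w -> v = w.

Lemma graph_mem_pr g i v : graph_mem g (pr i v) <-> proj1_sig g i = Some v.
Proof.
  split; [|intros; now exists i, v].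
  now intros (j & w & [<- <-]%pr_inj & H).
Qed.

Lemma graph_mem_open a : is_open (Kbot k) (fun g => graph_mem g a).
Proof.
  intros g (i & v & -> & Hg).
  assert (forall n w, (if n =? i then Some v else None) = Some w -> in_range k w) as R.
  { intros n w; destruct (n =? i); [intros [= <-]; exact (proj2_sig g i v Hg)|easy]. }
  set (f := exist _ (fun n => if n =? i then Some v else None) R : pfun k).
  assert (forall g', graph_sub f g' <-> proj1_sig g' i = Some v) as Hf.
  { intros g'; split.
    - intros H; apply H; cbn; now rewrite Nat.eqb_refl.
    - intros H n w; cbn; destruct (Nat.eqb_spec n i); [intros [= <-]; now subst|easy]. }
  exists [fun g' => graph_sub f g']; split; [|split].
  - intros B [<-|[]]; exists f; split; [|easy].
    exists (S i); intros n Ln; cbn; destruct (Nat.eqb_spec n i); [lia|easy].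
  - intros B [<-|[]]; now apply Hf.
  - intros g' H; apply graph_mem_pr, (proj1 (Hf g')), (H (fun g => graph_sub f g)); now left.
Qed.

Lemma graph_point F : (forall a, In a F -> kvalid a) ->
  (forall a b, In a F -> In b F -> kok a b) -> exists g, forall a, graph_mem g a <-> In a F.
Proof.
  intros V O.
  destruct (functional_choice (fun i o => forall v, o = Some v <-> In (pr i v) F)) as [g Hg].
  { intros i; destruct (classic (exists v, In (pr i v) F)) as [[v Hv]|N].
    - exists (Some v); intros w; split; [now intros [= <-]|].
      intros Hw; f_equal; now apply (O _ _ Hv Hw i).
    - exists None; intros v; split; [easy|]; intros Hv; destruct N; eauto. }
  assert (forall i v, g i = Some v -> in_range k v) as R.
  { intros i v Hv%Hg; destruct (V _ Hv) as (j & w & [_ ->]%pr_inj & H); easy. }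
  exists (exist _ g R); intros a; split.
  - intros (i & v & -> & H); now apply Hg.
  - intros Ha; destruct (V a Ha) as (i & v & -> & _); exists i, v; split; [easy|]; now apply Hg.
Qed.

Lemma graph_subbase B : subbase (Kbot k) B ->
  exists F, forall g, B g <-> forall a, In a F -> graph_mem g a.
Proof.
  intros (f & [N HN] & HB).
  exists (flat_map (fun n =>
    match proj1_sig f n with Some v => [pr n v] | None => [] end) (seq 0 N)).
  intros g; rewrite HB; split.
  - intros Hs a (n & _ & Ha)%in_flat_map.
    destruct (proj1_sig f n) as [v|] eqn:E; [|easy]; destruct Ha as [<-|[]].
    now apply graph_mem_pr, Hs.
  - intros H n v E; apply graph_mem_pr, H, in_flat_map.
    exists n; rewrite E; split; [|now left]; apply in_seq.
    destruct (le_lt_dec N n) as [L|L]; [rewrite HN in E by easy; easy|lia].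
Qed.

(** Ends with [Defined] so that [valid] and [ok] reduce to [kvalid] and [kok] when [mequiv_N2] is
    applied. *)
Definition Kbot_presentation : presentation (Kbot k).
Proof.
  refine (Build_presentation (Kbot k) graph_mem kvalid kok graph_mem_open _ _ _ _ graph_point
    (base_of_subbase (Kbot k) graph_mem graph_subbase)).
  - intros g a (i & v & -> & Hg); exists i, v; split; [easy|exact (proj2_sig g i v Hg)].
  - intros g a b (i & v & -> & Hv) (j & w & -> & Hw) i' v' w' [<- <-]%pr_inj [-> <-]%pr_inj.
    congruence.
  - now intros a _ i v w -> [_ ->]%pr_inj.
  - intros a b H i v w Ha Hb; symmetry; eauto.
Defined.

End Kbot.

(* The variable [7] is forced to be 1, the idempotent [d] with [d + d <> d]. *)
Fixpoint lt_form (k x y : nat) : form :=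
  match k with
  | 0 => FFalse
  | S k => FOr (FRel 3 [x; x; x])
      (FEx y (FAnd (FEx 7 (FAnd (FAnd (FRel 4 [7; 7; 7]) (FNot (FRel 3 [7; 7; 7])))
                                (FRel 3 [y; 7; x])))
                   (lt_form k y x)))
  end.

(** Either [x] is 0, the solution of [x + x = x], or it has a predecessor below [k - 1]. The two
    variables exchange roles at each step, so the same pair suffices for every [k], and the
    induction is over both. *)
Lemma sat_lt k : forall x y (rho : nat -> N2_dom) v, x <> y -> x <> 7 -> y <> 7 ->
  rho x = inl v -> sat N2 rho (lt_form k x y) <-> v < k.
Proof.
  induction k as [|k IH]; intros x y rho v Nxy Nx Ny Hx; cbn [lt_form sat]; [lia|].
  cbn [interp N2 map].
  assert (forall u : N2_dom, (exists d, (N2_interp 4 [d; d; d] /\ ~ N2_interp 3 [d; d; d]) /\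
     N2_interp 3 [u; d; inl v]) <-> exists m, u = inl m /\ m + 1 = v) as Succ.
  { intros u; split.
    - intros ([d|] & [H1 H2] & H3); [|easy]; destruct u as [m|]; [|easy]; cbn in *.
      exists m; split; [easy|]; nia.
    - intros (m & -> & <-); exists (inl 1); cbn; lia. }
  rewrite Hx; split.
  - intros [H|(u & H & Hu)]; [cbn in H; lia|].
    assert (exists d, (N2_interp 4 [d; d; d] /\ ~ N2_interp 3 [d; d; d]) /\
     N2_interp 3 [u; d; inl v]) as (m & -> & <-)%Succ.
    { destruct H as (d & H); exists d; revert H.
      now rewrite !upd_eq, !(upd_neq _ 7 y), !(upd_neq _ 7 x), upd_eq, (upd_neq _ y x), Hx by easy. }
    rewrite (IH _ _ _ m) in Hu; [lia|easy|easy|easy|apply upd_eq].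
  - intros L; destruct v as [|v]; [left; cbn; lia|right].
    exists (inl v); split; [|rewrite (IH _ _ _ v); [lia|easy|easy|easy|apply upd_eq]].
    destruct (proj2 (Succ (inl v))) as (d & H); [exists v; split; [easy|lia]|].
    exists d; revert H.
    now rewrite !upd_eq, !(upd_neq _ 7 y), !(upd_neq _ 7 x), upd_eq, (upd_neq _ y x), Hx by easy.
Qed.

Lemma free_lt k : forall x y z, free_in z (lt_form k x y) -> z = x.
Proof.
  induction k as [|k IH]; intros x y z; cbn; [easy|].
  intros [|(N & [H|H%IH])]; [intuition|intuition congruence|easy].
Qed.

Lemma wf_lt k : forall x y, wf sig_N2 (lt_form k x y).
Proof. induction k as [|k IH]; intros x y; cbn; intuition. Qed.

Definition range_form (k : option nat) : form :=
  match k with Some k => lt_form k 5 6 | None => FNot FFalse end.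

Definition kvalid_form (k : option nat) : form :=
  FEx 4 (FEx 5 (FAnd (pr_form 4 5 2) (range_form k))).

Definition kok_form : form :=
  FAll 4 (FAll 5 (FAll 6 (FImp (FAnd (pr_form 4 5 2) (pr_form 4 6 3)) (FEq 5 6)))).

Lemma defines_kvalid k : defines_unary (kvalid_form k) (kvalid k).
Proof.
  assert (wf sig_N2 (range_form k)) as W by (destruct k; [apply wf_lt|exact I]).
  assert (forall z, free_in z (range_form k) -> z = 5) as F.
  { destruct k as [k|]; [apply (free_lt k 5 6)|now intros z []]. }
  assert (forall (rho : nat -> N2_dom) v, rho 5 = inl v ->
    sat N2 rho (range_form k) <-> in_range k v) as S.
  { destruct k as [k|]; [intros; now apply sat_lt|cbn; tauto]. }
  split; [cbn; tauto|split].
  - intros x; cbn; intros (N4 & N5 & [H|H%F]); [intuition congruence|congruence].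
  - intros rho a Ha; cbn [sat kvalid_form]; split.
    + intros (d & e & H & R); apply sat_pr in H as (i & v & _ & Hv & Hi); [|lia..].
      exists i, v; split; [cbn -[pr] in Hi; congruence|].
      now apply (S _ v Hv) in R.
    + intros (i & v & -> & R); exists (inl i), (inl v); split.
      * apply sat_pr; [lia..|]; exists i, v; cbn -[pr]; auto.
      * now apply (S _ v eq_refl).
Qed.

Lemma defines_kok : defines_binary kok_form kok.
Proof.
  split; [cbn; tauto|split].
  - intros x; cbn; lia.
  - intros rho a b Ha Hb; cbn [sat kok_form]; split.
    + intros H i v w -> ->; specialize (H (inl i) (inl v) (inl w)).
      enough (inl v = inl w :> N2_dom) as [= ->] by easy; apply H; split.
      * apply sat_pr; [lia..|]; exists i, v; cbn -[pr]; auto.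
      * apply sat_pr; [lia..|]; exists i, w; cbn -[pr]; auto.
    + intros H d e f [H1 H2].
      apply sat_pr in H1 as (i & v & Hd & He & H1); [|lia..].
      apply sat_pr in H2 as (i' & w & Hd' & Hf & H2); [|lia..].
      cbn -[pr] in *; subst d e f; injection Hd' as <-.
      rewrite Ha in H1; rewrite Hb in H2; injection H1 as ->; injection H2 as ->.
      f_equal; now apply (H i).
Qed.

Lemma mequiv_Kbot k : in_range k 0 ->
  mequiv (codes (FO sig_lattice (Sigma01_str (Kbot k)))) (codes (FO sig_N2 N2)).
Proof.
  (* The atoms [pr i 0] all belong to the constant function 0, hence are pairwise consistent. *)
  intros R; apply (mequiv_N2 (Kbot_presentation k) (fun i => pr i 0)) with (kvalid_form k) kok_form.
  - now intros i j []%pr_inj.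
  - intros i; now exists i, 0.
  - now intros i j i' v w [_ <-]%pr_inj [_ <-]%pr_inj.
  - apply defines_kvalid.
  - apply defines_kok.
Qed.

Theorem theorem3p3 :
  mequiv (codes (FO sig_lattice (Sigma01_str Pomega))) (codes (FO sig_N2 N2)) /\
  (forall k : nat, 2 <= k ->
     mequiv (codes (FO sig_lattice (Sigma01_str (Kbot (Some k)))))
            (codes (FO sig_N2 N2))) /\
  mequiv (codes (FO sig_lattice (Sigma01_str (Kbot None))))
         (codes (FO sig_N2 N2)).
Proof.
  split; [|split].
  - destruct Pomega_presentation as (PX & HV & HO).
    apply (mequiv_N2 PX (fun i => i)) with (FNot FFalse) (FNot FFalse); auto.
    + repeat split; cbn; easy || auto.
    + repeat split; cbn; easy || auto.
  - intros k L; apply mequiv_Kbot; cbn; lia.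
  - now apply mequiv_Kbot.
Qed.
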